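(* Let $\{\Phi_t\}_{t\ge 0}$ be a continuous semigroup in the Gordon-Hedenmalm class, that is, a continuous semigroup in $\mathbb{C}_+$ such that $\Phi_t\in\mathcal{G}$ for every $t>0$. Then $\{\Phi_t\}$ converges to the identity map uniformly in the right half-plane $\mathbb{C}_+$, as $t$ goes to $0^+$.
   Context: For $\theta\in\mathbb{R}$, $\mathbb{C}_{\theta}=\{s\in\mathbb{C}:\mathrm{Re}(s)>\theta\}$, and $\mathbb{C}_+=\mathbb{C}_0$. A continuous semigroup in $\mathbb{C}_+$ is a family $\{\Phi_t\}_{t\geq 0}$ of holomorphic functions $\Phi_t:\mathbb{C}_+\to\mathbb{C}_+$ such that: (i) $\Phi_0(z)=z$ for all $z\in\mathbb{C}_+$; (ii) $\Phi_t\circ\Phi_u=\Phi_{t+u}$ for all $t,u\geq 0$; (iii) $\Phi_t\to\Phi_0$ uniformly on compact subsets of $\mathbb{C}_+$ as $t\to 0^+$. $\mathcal{D}$ denotes the space of Dirichlet series $\varphi(s)=\sum_{n=1}^{\infty}a_n n^{-s}$ (with complex coefficients) that converge in some half-plane $\mathbb{C}_{\theta}$. An analytic function $\Phi:\mathbb{C}_+\to\mathbb{C}_+$ belongs to the class $\mathcal{G}_{\infty}$ if there exist $c_{\Phi}\in\mathbb{N}\cup\{0\}$ and $\varphi\in\mathcal{D}$ such that $\Phi(z)=c_{\Phi}z+\varphi(z)$ (i.e. the holomorphic function $\Phi(z)-c_\Phi z$ is given by a convergent Dirichlet series in some half-plane). $\Phi$ belongs to the Gordon-Hedenmalm class $\mathcal{G}$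 if $\Phi\in\mathcal{G}_{\infty}$ and, in case $c_{\Phi}=0$, $\Phi(\mathbb{C}_+)\subset\mathbb{C}_{1/2}$. *)

(* Defs.v *)
From Stdlib Require Import Reals List.
From Coquelicot Require Export Coquelicot.
Open Scope R_scope.

Definition half_plane (theta : R) (s : C) : Prop := theta < Re s.

(* Maps on C_+ are total functions [C -> C]; only their values on
   [half_plane 0] are ever constrained. *)

Definition holomorphic_on (U : C -> Prop) (f : C -> C) : Prop :=
  forall z : C, U z -> @ex_derive C_AbsRing C_NormedModule f z.

Definition maps_into (U V : C -> Prop) (f : C -> C) : Prop :=
  forall z : C, U z -> V (f z).

Definition compact_set (K : C -> Prop) : Prop :=
  forall (I : Type) (U : I -> C -> Prop),
    (forall i : I, @open C_UniformSpace (U i)) ->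
    (forall z : C, K z -> exists i : I, U i z) ->
    exists l : list I, forall z : C, K z -> exists i : I, In i l /\ U i z.

(* [F t] tends to [f] uniformly on [E] as t -> 0+. *)
Definition cvg_unif_at_0 (E : C -> Prop) (F : R -> C -> C) (f : C -> C) : Prop :=
  forall eps : posreal,
    at_right 0 (fun t : R => forall z : C, E z -> Cmod (F t z - f z)%C < eps).

Record continuous_semigroup (Phi : R -> C -> C) : Prop := {
  csg_holomorphic : forall t : R, 0 <= t -> holomorphic_on (half_plane 0) (Phi t);
  csg_self_map : forall t : R, 0 <= t ->
    maps_into (half_plane 0) (half_plane 0) (Phi t);
  csg_id : forall z : C, half_plane 0 z -> Phi 0 z = z;
  csg_comp : forall (t u : R) (z : C), 0 <= t -> 0 <= u -> half_plane 0 z ->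
    Phi t (Phi u z) = Phi (t + u) z;
  csg_cont : forall K : C -> Prop, compact_set K ->
    (forall z : C, K z -> half_plane 0 z) -> cvg_unif_at_0 K Phi (Phi 0)
}.

Definition Cexp (z : C) : C := (exp (Re z) * cos (Im z), exp (Re z) * sin (Im z)).

(* n^{-s}, for n >= 1 *)
Definition nat_Cpow_opp (n : nat) (s : C) : C := Cexp (- s * RtoC (ln (INR n)))%C.

(* The Dirichlet series sum_{n >= 1} a_n n^{-s} converges with sum [l]; the
   library's series start at index 0, hence the shift, and [a 0] is not used. *)
Definition is_dirichlet_series (a : nat -> C) (s l : C) : Prop :=
  @is_series C_AbsRing C_NormedModule
    (fun n : nat => a (S n) * nat_Cpow_opp (S n) s)%C l.

Definition dirichlet_converges_on (a : nat -> C) (theta : R) : Prop :=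
  forall s : C, half_plane theta s -> exists l : C, is_dirichlet_series a s l.

(* Phi(z) = c z + phi(z) with phi a Dirichlet series convergent in some
   half-plane; the identity is required wherever both sides are defined. The
   number [c] is determined by [Phi]. *)
Definition has_expansion (Phi : C -> C) (c : nat) : Prop :=
  exists (a : nat -> C) (theta : R),
    dirichlet_converges_on a theta /\
    forall z : C, half_plane 0 z -> half_plane theta z ->
      is_dirichlet_series a z (Phi z - RtoC (INR c) * z)%C.

Definition class_G_infty (Phi : C -> C) : Prop :=
  holomorphic_on (half_plane 0) Phi /\
  maps_into (half_plane 0) (half_plane 0) Phi /\
  exists c : nat, has_expansion Phi c.

Definition class_G (Phi : C -> C) : Prop :=
  class_G_infty Phi /\
  (has_expansion Phi 0 -> maps_into (half_plane 0) (half_plane (1 / 2)) Phi).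

(* Main.v *)
Require Import Defs.
From Stdlib Require Import Reals.
From Coquelicot Require Import Coquelicot.
From Stdlib Require Import Lra Lia Psatz List.

(** Write [Phi t z = c z + phi z], with [phi] a Dirichlet series. A nonzero [c] is squared when
    the time is doubled; since [c] is an integer for all the times [t / 2 ^ n], it is [0] or
    [1], and [0] is impossible for maps into [Re z > 1/2] that tend to the identity
    ([coefficient_one]). Hence
    [phi z = Phi t z - z] tends to a constant [a], exponentially fast, as [Re z] tends to
    infinity. A maximum principle for the half-plane ([max_principle_half_plane]), applied to
    [e^(- phi)] and then to a Schwarz quotient of [phi], gives [Re phi >= 0] and
    [|phi z - a| Re z <= 4 Re a] ([expansion_drift]). The drift [a] is additive in [t] and tends
    to [0] with [t], because it is controlled by the displacement of a single point. This
    already yields uniform convergence on [Re z >= eps] for each positive [eps].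

    Near the imaginary axis the bound on [phi] degenerates like [|a| / Re z], and only the
    semigroup law can help: a single map could move boundary points very far. Let
    [A >= |a|], and let [D] be the displacement of [z] at time [t]. Follow [z] under
    [Phi (t / N)]: it moves in [N] steps with the velocity field [H = N phi_(t / N)], which has
    [Re H >= 0] and [|H z| <= A + 4 A / Re z] uniformly in [N]. By Kolmogorov's device for
    conjugate functions, consider the root [G] of [H]. On the one hand, the integral of [G dz]
    along the trajectory does not depend on the path; since [|G|] is at most of the order of
    [sqrt A (1 + 1 / sqrt (Re z))], which is integrable up to the axis, pushing the path away
    from the axis by [D] bounds it by a multiple of [sqrt A (D + sqrt D)]
    ([potential_path_bound]). On the other hand [dz = H dt], so it is the time integral of
    [H^(3/2)]. The real part of [- H^(3/2)] dominates [|H|^(3/2)] up to a multiple of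
    [|H|^(1/2) Re H] ([sqrt_cube_identity]), and [Re H dt = d(Re z)], so that this correction is
    again an integral of [1 / sqrt x]. Thus the time integral of [|H|^(3/2)] is at most a
    multiple of [sqrt A (D + sqrt D)]. By Hoelder's inequality it controls the time integral of
    [|H|], which is at least [D] ([trajectory_bound], [displacement_estimate]). The resulting
    inequality forces [D] to be small with [A], for all [z] at once.

    Everything rests on Goursat's theorem for rectangles ([goursat]). In logarithmic polar
    coordinates it gives the mean value property and Cauchy's estimate, hence the maximum
    principle and the Lipschitz bounds that make the sums over [N] steps converge. *)

(** * Complex differentiation *)

(** Normed as an absolute ring, the codomain is the ring [C] itself, so the
    product and chain rules for maps of a ring into itself apply. *)
Definition Cderiv (f : C -> C) (z l : C) : Prop :=
  @is_derive C_AbsRing (AbsRing_NormedModule C_AbsRing) f z l.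

Lemma Cderiv_eps (f : C -> C) (z l : C) :
  Cderiv f z l <->
  forall eps : R, 0 < eps -> exists delta : R, 0 < delta /\
    forall w : C, Cmod (w - z) < delta ->
      Cmod (f w - f z - (w - z) * l) <= eps * Cmod (w - z).
Proof.
  split.
  - intros [_ H] eps Heps.
    destruct (H z (fun P HP => HP) (mkposreal eps Heps)) as [d Hd].
    exists d; split; [apply cond_pos|]. intros w Hw. exact (Hd w Hw).
  - intros H; split.
    + apply is_linear_scal_l.
    + intros x Hx. apply (is_filter_lim_locally_unique (V := AbsRing_NormedModule C_AbsRing) z x) in Hx.
      subst x.
      intros eps. destruct (H eps (cond_pos eps)) as [d [Hd H1]].
      exists (mkposreal d Hd). intros w Hw. exact (H1 w Hw).
Qed.

Lemma Cderiv_of_is_derive (f : C -> C) (z l : C) :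
  @is_derive C_AbsRing C_NormedModule f z l -> Cderiv f z l.
Proof.
  intros [_ H]. apply Cderiv_eps. intros eps Heps.
  destruct (H z (fun P HP => HP) (mkposreal eps Heps)) as [d Hd].
  exists d; split; [apply cond_pos|]. intros w Hw. exact (Hd w Hw).
Qed.

Lemma Cderiv_ext (f : C -> C) (z l l' : C) : Cderiv f z l -> l = l' -> Cderiv f z l'.
Proof. intros H <-; exact H. Qed.

Lemma Cderiv_const (c z : C) : Cderiv (fun _ => c) z 0.
Proof. exact (is_derive_const (V := AbsRing_NormedModule C_AbsRing) c z). Qed.

Lemma Cderiv_id (z : C) : Cderiv (fun w => w) z 1.
Proof. exact (is_derive_id (K := C_AbsRing) z). Qed.

Lemma Cderiv_plus (f g : C -> C) (z l m : C) :
  Cderiv f z l -> Cderiv g z m -> Cderiv (fun w => (f w + g w)%C) z (l + m)%C.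
Proof. exact (is_derive_plus (V := AbsRing_NormedModule C_AbsRing) f g z l m). Qed.

Lemma Cderiv_minus (f g : C -> C) (z l m : C) :
  Cderiv f z l -> Cderiv g z m -> Cderiv (fun w => (f w - g w)%C) z (l - m)%C.
Proof. exact (is_derive_minus (V := AbsRing_NormedModule C_AbsRing) f g z l m). Qed.

Lemma Cderiv_mult (f g : C -> C) (z l m : C) :
  Cderiv f z l -> Cderiv g z m ->
  Cderiv (fun w => (f w * g w)%C) z (l * g z + f z * m)%C.
Proof.
  intros Hf Hg. exact (is_derive_mult (K := C_AbsRing) f g z l m Hf Hg Cmult_comm).
Qed.

Lemma Cderiv_opp (f : C -> C) (z l : C) :
  Cderiv f z l -> Cderiv (fun w => (- f w)%C) z (- l)%C.
Proof. exact (is_derive_opp (V := AbsRing_NormedModule C_AbsRing) f z l). Qed.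

Lemma Cderiv_comp (f g : C -> C) (z l m : C) :
  Cderiv f (g z) l -> Cderiv g z m -> Cderiv (fun w => f (g w)) z (m * l)%C.
Proof. exact (is_derive_comp (V := AbsRing_NormedModule C_AbsRing) f g z l m). Qed.

Lemma Cmod_minus_sym (z w : C) : Cmod (z - w) = Cmod (w - z).
Proof. rewrite <- Cmod_opp. f_equal. ring. Qed.

Lemma Cmod_le_add (z w : C) : Cmod z <= Cmod w + Cmod (z - w).
Proof.
  replace z with (w + (z - w))%C at 1 by ring. apply Cmod_triangle.
Qed.

Lemma Cmod_minus_le (z w : C) : Cmod (z - w) <= Cmod z + Cmod w.
Proof.
  unfold Cminus. rewrite <- (Cmod_opp w). apply Cmod_triangle.
Qed.

Lemma im_le_Cmod (z : C) : Rabs (Im z) <= Cmod z.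
Proof.
  eapply Rle_trans; [|apply Rmax_Cmod]. apply Rmax_r.
Qed.

Lemma Cmod_le_re_im (z : C) : Cmod z <= Rabs (Re z) + Rabs (Im z).
Proof.
  assert (E : z = (RtoC (Re z) + Ci * RtoC (Im z))%C).
  { destruct z as [x y]. unfold RtoC, Ci, Cplus, Cmult; simpl. f_equal; ring. }
  rewrite E at 1. eapply Rle_trans; [apply Cmod_triangle|].
  rewrite Cmod_mult, Cmod_Ci, !Cmod_R. lra.
Qed.

Lemma Re_plus (z w : C) : Re (z + w)%C = Re z + Re w. Proof. reflexivity. Qed.
Lemma Re_opp (z : C) : Re (- z)%C = - Re z. Proof. reflexivity. Qed.
Lemma Re_minus (z w : C) : Re (z - w)%C = Re z - Re w. Proof. reflexivity. Qed.
Lemma Im_minus (z w : C) : Im (z - w)%C = Im z - Im w. Proof. reflexivity. Qed.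
Lemma Re_RtoC (x : R) : Re (RtoC x) = x. Proof. reflexivity. Qed.
Lemma Re_mult_R (x : R) (z : C) : Re (RtoC x * z)%C = x * Re z.
Proof. unfold Cmult, RtoC; simpl. fold (Re z). ring. Qed.

Lemma Cderiv_continuous (f : C -> C) (z l : C) : Cderiv f z l ->
  forall eps, 0 < eps -> exists delta, 0 < delta /\
    forall w, Cmod (w - z) < delta -> Cmod (f w - f z) < eps.
Proof.
  intros H eps Heps. rewrite Cderiv_eps in H.
  destruct (H 1 Rlt_0_1) as [d [Hd H1]].
  set (K := 1 + Cmod l).
  assert (HK : 0 < K) by (unfold K; pose proof (Cmod_ge_0 l); lra).
  exists (Rmin d (eps / K)). split.
  { apply Rmin_pos; auto. apply Rdiv_lt_0_compat; auto. }
  intros w Hw.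
  assert (Hw1 := Rlt_le_trans _ _ _ Hw (Rmin_l _ _)).
  assert (Hw2 := Rlt_le_trans _ _ _ Hw (Rmin_r _ _)).
  specialize (H1 w Hw1).
  pose proof (Cmod_le_add (f w - f z) ((w - z) * l)) as H2.
  rewrite Cmod_mult in H2.
  apply Rle_lt_trans with (Cmod (w - z) * K); [unfold K; lra|].
  replace eps with (eps / K * K) by (field; lra).
  apply Rmult_lt_compat_r; auto.
Qed.

Lemma Cderiv_inv (z : C) : z <> 0 -> Cderiv Cinv z (- / (z * z))%C.
Proof.
  intros Hz. apply Cderiv_eps. intros eps Heps.
  assert (Hm : 0 < Cmod z) by (apply Cmod_gt_0; auto).
  set (m := Cmod z) in *.
  exists (Rmin (m / 2) (eps * (m * m * m) / 2)). split.
  { apply Rmin_pos; [lra|]. assert (0 < m * m * m) by (repeat apply Rmult_lt_0_compat; auto).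
    assert (0 < eps * (m * m * m)) by (apply Rmult_lt_0_compat; auto). lra. }
  intros w Hw.
  assert (Hw1 := Rlt_le_trans _ _ _ Hw (Rmin_l _ _)).
  assert (Hw2 := Rlt_le_trans _ _ _ Hw (Rmin_r _ _)).
  assert (Hmw : m / 2 < Cmod w).
  { pose proof (Cmod_le_add z w). rewrite (Cmod_minus_sym z w) in H. fold m in H. lra. }
  assert (Hw0 : w <> 0) by (apply Cmod_gt_0; lra).
  replace (/ w - / z - (w - z) * - / (z * z))%C
    with ((w - z) * ((w - z) * / (w * (z * z))))%C by (field; auto).
  rewrite !Cmod_mult, Cmod_inv, !Cmod_mult.
  2:{ repeat apply Cmult_neq_0; auto. }
  fold m. rewrite (Rmult_comm eps). apply Rmult_le_compat_l; [apply Cmod_ge_0|].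
  assert (0 < Cmod w * (m * m)) by (apply Rmult_lt_0_compat; nra).
  apply Rmult_le_reg_r with (Cmod w * (m * m)); auto.
  rewrite Rmult_assoc, Rinv_l by lra.
  assert (eps * (m * m) * (m / 2) <= eps * (m * m) * Cmod w).
  { apply Rmult_le_compat_l; [|lra]. assert (0 < m * m) by nra. nra. }
  lra.
Qed.

Lemma Rderiv_eps (f : R -> R) (x l : R) : is_derive f x l ->
  forall eps, 0 < eps -> exists d, 0 < d /\ forall h, Rabs h < d ->
    Rabs (f (x + h) - f x - h * l) <= eps * Rabs h.
Proof.
  intros [_ H] eps Heps.
  destruct (H x (fun P HP => HP) (mkposreal eps Heps)) as [d Hd].
  exists d; split; [apply cond_pos|]. intros h Hh.
  assert (B : ball x d (x + h)).
  { unfold ball; simpl. unfold AbsRing_ball, abs, minus, plus, opp; simpl.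
    now replace (x + h + - x) with h by ring. }
  specialize (Hd (x + h) B). simpl in Hd. unfold norm, minus, plus, opp, scal in Hd; simpl in Hd.
  unfold abs, mult in Hd; simpl in Hd.
  replace (x + h + - x) with h in Hd by ring. exact Hd.
Qed.

Lemma Cexp_plus (z w : C) : Cexp (z + w) = (Cexp z * Cexp w)%C.
Proof.
  destruct z as [a b], w as [c d]. unfold Cexp, Cmult, Cplus; simpl.
  rewrite exp_plus, cos_plus, sin_plus. f_equal; ring.
Qed.

Lemma Cmod_Cexp (z : C) : Cmod (Cexp z) = exp (Re z).
Proof.
  unfold Cmod, Cexp; simpl.
  replace (_ + _) with (exp (Re z) * exp (Re z) * (Rsqr (sin (Im z)) + Rsqr (cos (Im z))))
    by (unfold Rsqr; ring).
  rewrite sin2_cos2, Rmult_1_r. apply sqrt_square. left; apply exp_pos.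
Qed.

Lemma Cexp_0 : Cexp 0 = 1.
Proof. unfold Cexp; simpl. rewrite exp_0, cos_0, sin_0. unfold RtoC; f_equal; ring. Qed.

Lemma Cderiv_Cexp_0 : Cderiv Cexp 0 1.
Proof.
  apply Cderiv_eps. intros eps Heps.
  set (e := Rmin (eps / 10) 1).
  assert (He : 0 < e) by (apply Rmin_pos; lra).
  assert (He1 : e <= 1) by apply Rmin_r.
  assert (He2 : e <= eps / 10) by apply Rmin_l.
  clearbody e.
  destruct (Rderiv_eps exp 0 1 ltac:(auto_derive; auto; rewrite exp_0; ring) e He) as [d1 [Hd1 H1]].
  destruct (Rderiv_eps cos 0 0 ltac:(auto_derive; auto; rewrite sin_0; ring) e He) as [d2 [Hd2 H2]].
  destruct (Rderiv_eps sin 0 1 ltac:(auto_derive; auto; rewrite cos_0; ring) e He) as [d3 [Hd3 H3]].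
  exists (Rmin e (Rmin d1 (Rmin d2 d3))). split.
  { repeat apply Rmin_pos; auto. }
  intros w Hw. rewrite Cexp_0.
  replace (w - 0)%C with w in * by ring. replace (w * 1)%C with w by ring.
  pose proof (Rmin_l e (Rmin d1 (Rmin d2 d3))). pose proof (Rmin_r e (Rmin d1 (Rmin d2 d3))).
  pose proof (Rmin_l d1 (Rmin d2 d3)). pose proof (Rmin_r d1 (Rmin d2 d3)).
  pose proof (Rmin_l d2 d3). pose proof (Rmin_r d2 d3).
  pose proof (re_le_Cmod w) as Hx. pose proof (im_le_Cmod w) as Hy.
  destruct w as [x y]. unfold Re, Im in Hx, Hy; simpl in Hx, Hy. set (m := Cmod (x, y)) in *.
  specialize (H1 x ltac:(lra)). specialize (H2 y ltac:(lra)). specialize (H3 y ltac:(lra)).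
  rewrite Rplus_0_l in H1, H2, H3. rewrite exp_0 in H1. rewrite cos_0 in H2. rewrite sin_0 in H3.
  eapply Rle_trans; [apply Cmod_le_re_im|].
  unfold Cexp, Cminus, Cplus, Copp; simpl.
  assert (Hm : 0 <= m) by apply Cmod_ge_0.
  assert (C1 : Rabs (cos y) <= 1) by (apply Rabs_le; split; apply COS_bound).
  assert (S1 : Rabs (sin y) <= 1) by (apply Rabs_le; split; apply SIN_bound).
  replace (exp x * cos y + - (1) + - x)
    with ((exp x - 1 - x * 1) * cos y + (1 + x) * (cos y - 1 - y * 0)) by ring.
  replace (exp x * sin y + - 0 + - y)
    with ((exp x - 1 - x * 1) * sin y + (1 + x) * (sin y - 0 - y * 1) + x * y) by ring.
  assert (P : forall u v a b, 0 <= b -> Rabs u <= a -> Rabs v <= b -> Rabs (u * v) <= a * b).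
  { intros u v a b Hb Hu Hv. rewrite Rabs_mult. apply Rmult_le_compat; auto using Rabs_pos. }
  assert (E : e * Rabs x <= e * m) by (apply Rmult_le_compat_l; lra).
  assert (E' : e * Rabs y <= e * m) by (apply Rmult_le_compat_l; lra).
  assert (X2 : Rabs (1 + x) <= 2).
  { apply Rabs_le. destruct (Rabs_le_between x 1) as [Q _]. specialize (Q ltac:(lra)). lra. }
  assert (Hem : 0 <= e * m) by nra.
  (* the four remainders of exp, cos, sin at 0, and the product x y *)
  assert (T1 := P (exp x - 1 - x * 1) (cos y) (e * m) 1 ltac:(lra) ltac:(lra) C1).
  assert (T2 := P (1 + x) (cos y - 1 - y * 0) 2 (e * m) Hem X2 ltac:(lra)).
  assert (T3 := P (exp x - 1 - x * 1) (sin y) (e * m) 1 ltac:(lra) ltac:(lra) S1).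
  assert (T4 := P (1 + x) (sin y - 0 - y * 1) 2 (e * m) Hem X2 ltac:(lra)).
  assert (T5 := P x y e m Hm ltac:(lra) Hy).
  assert (T6 := Rabs_triang ((exp x - 1 - x * 1) * cos y) ((1 + x) * (cos y - 1 - y * 0))).
  assert (T7 := Rabs_triang ((exp x - 1 - x * 1) * sin y + (1 + x) * (sin y - 0 - y * 1)) (x * y)).
  assert (T8 := Rabs_triang ((exp x - 1 - x * 1) * sin y) ((1 + x) * (sin y - 0 - y * 1))).
  assert (10 * e * m <= eps * m) by (apply Rmult_le_compat_r; lra).
  lra.
Qed.

Lemma Cderiv_Cexp (z : C) : Cderiv Cexp z (Cexp z).
Proof.
  apply Cderiv_eps. intros eps Heps.
  assert (Hp := exp_pos (Re z)).
  destruct (proj1 (Cderiv_eps _ _ _) Cderiv_Cexp_0 (eps / exp (Re z))) as [d [Hd H]].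
  { apply Rdiv_lt_0_compat; auto. }
  exists d; split; auto. intros w Hw.
  specialize (H (w - z)%C). replace (w - z - 0)%C with (w - z)%C in H by ring.
  specialize (H Hw). rewrite Cexp_0 in H.
  replace (Cexp w - Cexp z - (w - z) * Cexp z)%C
    with (Cexp z * (Cexp (w - z) - 1 - (w - z) * 1))%C.
  2:{ replace (Cexp w) with (Cexp z * Cexp (w - z))%C by (rewrite <- Cexp_plus; f_equal; ring).
      ring. }
  rewrite Cmod_mult, Cmod_Cexp.
  replace (eps * Cmod (w - z)) with (exp (Re z) * (eps / exp (Re z) * Cmod (w - z))) by (field; lra).
  apply Rmult_le_compat_l; lra.
Qed.

(** The principal branch; its real part is positive on the open right half-plane. *)
Definition Csqrt (w : C) : C :=
  let p := sqrt ((Cmod w + Re w) / 2) in (p, Im w / (2 * p)).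

Lemma Csqrt_spec (w : C) : 0 < Re w -> (Csqrt w * Csqrt w)%C = w /\ 0 < Re (Csqrt w).
Proof.
  intros Hw. unfold Csqrt.
  pose proof (Cmod_ge_0 w) as Hm.
  set (p := sqrt ((Cmod w + Re w) / 2)).
  assert (Hp : 0 < p) by (apply sqrt_lt_R0; lra).
  assert (Hpp : p * p = (Cmod w + Re w) / 2) by (apply sqrt_sqrt; lra).
  split; [|exact Hp].
  pose proof (Cmod2_alt w) as H2.
  destruct w as [x y]; unfold Re, Im in *; simpl in *. set (m := Cmod (x, y)) in *.
  unfold Cmult; simpl. f_equal.
  - assert (E : (y / (2 * p)) * (y / (2 * p)) = y * y / (4 * (p * p))) by (field; lra).
    rewrite E, Hpp.
    replace (y * y) with (m * m - x * x) by nra.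
    field. lra.
  - field. lra.
Qed.

Lemma Re_Csqrt_pos (w : C) : 0 < Re w -> 0 < Re (Csqrt w).
Proof. intros H; apply (Csqrt_spec w H). Qed.

Lemma Csqrt_sqr (w : C) : 0 < Re w -> (Csqrt w * Csqrt w)%C = w.
Proof. intros H; apply (Csqrt_spec w H). Qed.

(** With [s], [r] the roots of [w], [v], the difference quotient is [1 / (r + s)], and
    [r + s] stays away from [0] because both roots have positive real part. *)
Lemma Cderiv_Csqrt (w : C) : 0 < Re w -> exists l, Cderiv Csqrt w l.
Proof.
  intros Hw. destruct (Csqrt_spec w Hw) as [Hs Hp].
  set (s := Csqrt w) in *. set (p := Re s) in *.
  assert (Hsp : p <= Cmod s) by (eapply Rle_trans; [apply Rle_abs|apply re_le_Cmod]).
  assert (Hs0 : s <> 0) by (apply Cmod_gt_0; lra).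
  exists (/ (2 * s))%C. apply Cderiv_eps. intros eps Heps.
  exists (Rmin (Re w) (eps * (p * p * p))). split.
  { apply Rmin_pos; auto. repeat apply Rmult_lt_0_compat; auto. }
  intros v Hv.
  assert (Hv1 := Rlt_le_trans _ _ _ Hv (Rmin_l _ _)).
  assert (Hv2 := Rlt_le_trans _ _ _ Hv (Rmin_r _ _)).
  assert (Rv : 0 < Re v).
  { pose proof (re_le_Cmod (v - w)) as Q. rewrite Re_minus in Q.
    pose proof (Rabs_le_between (Re v - Re w) (Cmod (v - w))) as [Q' _].
    specialize (Q' Q). lra. }
  destruct (Csqrt_spec v Rv) as [Hsv Hpv]. set (r := Csqrt v) in *. fold s.
  assert (Hrs : p <= Cmod (r + s)).
  { eapply Rle_trans; [|apply re_le_Cmod]. rewrite Re_plus. fold p. rewrite Rabs_pos_eq; lra. }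
  assert (Hrs0 : (r + s)%C <> 0) by (apply Cmod_gt_0; lra).
  assert (E : (r - s = (v - w) * / (r + s))%C).
  { rewrite <- Hsv, <- Hs. field. auto. }
  replace (r - s - (v - w) * / (2 * s))%C
    with ((v - w) * ((v - w) * - / (2 * s * ((r + s) * (r + s)))))%C.
  2:{ replace (r - s)%C with ((v - w) * / (r + s))%C by auto.
      rewrite <- Hsv, <- Hs. field. split; auto. }
  rewrite !Cmod_mult, Cmod_opp, Cmod_inv, !Cmod_mult.
  2:{ repeat apply Cmult_neq_0; auto. apply Cmod_gt_0. rewrite Cmod_R, Rabs_pos_eq; lra. }
  rewrite Cmod_R, (Rabs_pos_eq 2) by lra.
  rewrite (Rmult_comm eps). apply Rmult_le_compat_l; [apply Cmod_ge_0|].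
  set (D := 2 * Cmod s * (Cmod (r + s) * Cmod (r + s))).
  assert (HD : p * p * p <= D).
  { unfold D. assert (p * p <= Cmod (r + s) * Cmod (r + s)) by nra.
    replace (p * p * p) with (p * (p * p)) by ring. apply Rmult_le_compat; nra. }
  assert (0 < p * p * p) by (repeat apply Rmult_lt_0_compat; auto).
  apply Rmult_le_reg_r with D; [lra|].
  rewrite Rmult_assoc, Rinv_l by lra. nra.
Qed.

Definition holo_at (f : C -> C) (z : C) : Prop := exists l, Cderiv f z l.

Lemma holo_continuous (f : C -> C) (z : C) : holo_at f z ->
  forall eps, 0 < eps -> exists delta, 0 < delta /\
    forall w, Cmod (w - z) < delta -> Cmod (f w - f z) < eps.
Proof. intros [l H]. exact (Cderiv_continuous f z l H). Qed.

Lemma holo_comp (f g : C -> C) (z : C) :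
  holo_at f (g z) -> holo_at g z -> holo_at (fun w => f (g w)) z.
Proof. intros [l Hl] [m Hm]. exists (m * l)%C. now apply Cderiv_comp. Qed.

Lemma holo_mult (f g : C -> C) (z : C) :
  holo_at f z -> holo_at g z -> holo_at (fun w => f w * g w)%C z.
Proof. intros [l Hl] [m Hm]. eexists. apply Cderiv_mult; eauto. Qed.

Lemma holo_plus (f g : C -> C) (z : C) :
  holo_at f z -> holo_at g z -> holo_at (fun w => f w + g w)%C z.
Proof. intros [l Hl] [m Hm]. eexists. apply Cderiv_plus; eauto. Qed.

Lemma holo_minus (f g : C -> C) (z : C) :
  holo_at f z -> holo_at g z -> holo_at (fun w => f w - g w)%C z.
Proof. intros [l Hl] [m Hm]. eexists. apply Cderiv_minus; eauto. Qed.

Lemma holo_opp (f : C -> C) (z : C) : holo_at f z -> holo_at (fun w => - f w)%C z.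
Proof. intros [l Hl]. eexists. apply Cderiv_opp; eauto. Qed.

Lemma holo_const (c z : C) : holo_at (fun _ => c) z.
Proof. eexists. apply Cderiv_const. Qed.

Lemma holo_id (z : C) : holo_at (fun w => w) z.
Proof. eexists. apply Cderiv_id. Qed.

Lemma holo_Cexp (z : C) : holo_at Cexp z.
Proof. eexists. apply Cderiv_Cexp. Qed.

Lemma holo_div (f g : C -> C) (z : C) : g z <> 0 ->
  holo_at f z -> holo_at g z -> holo_at (fun w => f w / g w)%C z.
Proof.
  intros Hg0 Hf Hg. apply holo_mult; auto. apply (holo_comp Cinv g); auto.
  eexists. apply Cderiv_inv; auto.
Qed.


(** * Goursat's theorem *)

Notation CV := C_R_CompleteNormedModule.

Lemma norm_C_R (z : C) : @norm R_AbsRing C_R_NormedModule z = Cmod z.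
Proof.
  unfold norm; simpl. unfold prod_norm, Cmod, norm; simpl. unfold abs; simpl.
  destruct z as [x y]; simpl. f_equal.
  rewrite !Rmult_1_r, <- !Rabs_mult, !Rabs_pos_eq by nra. reflexivity.
Qed.

Lemma scal_C_R (k : R) (z : C) : @scal R_AbsRing C_R_NormedModule k z = (RtoC k * z)%C.
Proof.
  destruct z as [x y]. unfold scal; simpl. unfold prod_scal, scal; simpl.
  unfold mult; simpl. unfold RtoC, Cmult; simpl. f_equal; ring.
Qed.

Lemma continuous_C_R (F : R -> C) (u : R) :
  (forall eps, 0 < eps -> exists d, 0 < d /\ forall v, Rabs (v - u) < d ->
     Cmod (F v - F u) < eps) ->
  @continuous R_UniformSpace C_R_NormedModule F u.
Proof.
  intros H. apply filterlim_locally_ball_norm.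
  intros eps. destruct (H eps (cond_pos eps)) as [d [Hd H1]].
  exists (mkposreal d Hd). intros v Hv.
  unfold ball_norm. rewrite norm_C_R. apply H1. exact Hv.
Qed.

Lemma is_derive_C_R (F : R -> C) (u : R) (l : C) :
  (forall eps, 0 < eps -> exists d, 0 < d /\ forall v, Rabs (v - u) < d ->
     Cmod (F v - F u - RtoC (v - u) * l) <= eps * Rabs (v - u)) ->
  @is_derive R_AbsRing C_R_NormedModule F u l.
Proof.
  intros H. split; [apply is_linear_scal_l|].
  intros x Hx. apply (is_filter_lim_locally_unique (V := AbsRing_NormedModule R_AbsRing) u x) in Hx.
  subst x.
  intros eps. destruct (H eps (cond_pos eps)) as [d [Hd H1]].
  exists (mkposreal d Hd). intros v Hv. rewrite norm_C_R, scal_C_R. exact (H1 v Hv).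
Qed.

Lemma horizontal_step (u v y : R) : ((v, y) - (u, y))%C = RtoC (v - u).
Proof. unfold Cminus, Cplus, Copp, RtoC; simpl. f_equal; ring. Qed.

Lemma vertical_step (x u v : R) : ((x, v) - (x, u))%C = (RtoC (v - u) * Ci)%C.
Proof. unfold Cminus, Cplus, Copp, RtoC, Cmult, Ci; simpl. f_equal; ring. Qed.

Lemma Cmod_horizontal_step (u v y : R) : Cmod ((v, y) - (u, y)) = Rabs (v - u).
Proof. rewrite horizontal_step. apply Cmod_R. Qed.

Lemma Cmod_vertical_step (x u v : R) : Cmod ((x, v) - (x, u)) = Rabs (v - u).
Proof. rewrite vertical_step, Cmod_mult, Cmod_R, Cmod_Ci. ring. Qed.

Lemma Cderiv_horizontal (F : C -> C) (u y : R) (l : C) : Cderiv F (u, y) l ->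
  @is_derive R_AbsRing C_R_NormedModule (fun u => F (u, y)) u l.
Proof.
  intros H. apply is_derive_C_R. intros eps Heps. rewrite Cderiv_eps in H.
  destruct (H eps Heps) as [d [Hd H1]]. exists d; split; auto.
  intros v Hv. specialize (H1 (v, y)). rewrite Cmod_horizontal_step, horizontal_step in H1. auto.
Qed.

Lemma Cderiv_vertical (F : C -> C) (x u : R) (l : C) : Cderiv F (x, u) l ->
  @is_derive R_AbsRing C_R_NormedModule (fun u => F (x, u)) u (Ci * l)%C.
Proof.
  intros H. apply is_derive_C_R. intros eps Heps. rewrite Cderiv_eps in H.
  destruct (H eps Heps) as [d [Hd H1]]. exists d; split; auto.
  intros v Hv. specialize (H1 (x, v)). rewrite Cmod_vertical_step, vertical_step in H1.
  rewrite Cmult_assoc. auto.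
Qed.

Lemma holo_continuous_horizontal (f : C -> C) (u y : R) : holo_at f (u, y) ->
  @continuous R_UniformSpace C_R_NormedModule (fun u => f (u, y)) u.
Proof.
  intros H. apply continuous_C_R. intros eps Heps.
  destruct (holo_continuous f _ H eps Heps) as [d [Hd H1]].
  exists d; split; auto. intros v Hv. apply H1. now rewrite Cmod_horizontal_step.
Qed.

Lemma holo_continuous_vertical (f : C -> C) (x u : R) : holo_at f (x, u) ->
  @continuous R_UniformSpace C_R_NormedModule (fun u => f (x, u)) u.
Proof.
  intros H. apply continuous_C_R. intros eps Heps.
  destruct (holo_continuous f _ H eps Heps) as [d [Hd H1]].
  exists d; split; auto. intros v Hv. apply H1. now rewrite Cmod_vertical_step.
Qed.

Ltac simpl_minmax := rewrite ?Rmin_left, ?Rmax_right in * by lra.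

Definition hintegral (f : C -> C) (y a b : R) : C := @RInt CV (fun u => f (u, y)) a b.
(** The integral in the real variable [v]; the integral of [f dz] along the same vertical
    segment is [Ci] times it. *)
Definition vintegral (f : C -> C) (x c d : R) : C := @RInt CV (fun v => f (x, v)) c d.

Lemma ex_hintegral (f : C -> C) (y a b : R) :
  (forall u, Rmin a b <= u <= Rmax a b -> holo_at f (u, y)) ->
  @ex_RInt C_R_NormedModule (fun u => f (u, y)) a b.
Proof.
  intros H. apply (ex_RInt_continuous (V := CV)). intros u Hu.
  apply holo_continuous_horizontal. auto.
Qed.

Lemma ex_vintegral (f : C -> C) (x c d : R) :
  (forall v, Rmin c d <= v <= Rmax c d -> holo_at f (x, v)) ->
  @ex_RInt C_R_NormedModule (fun v => f (x, v)) c d.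
Proof.
  intros H. apply (ex_RInt_continuous (V := CV)). intros u Hu.
  apply holo_continuous_vertical. auto.
Qed.

Lemma hintegral_Chasles (f : C -> C) (y a b c : R) :
  (forall u, Rmin a b <= u <= Rmax a b -> holo_at f (u, y)) ->
  (forall u, Rmin b c <= u <= Rmax b c -> holo_at f (u, y)) ->
  hintegral f y a c = (hintegral f y a b + hintegral f y b c)%C.
Proof.
  intros H1 H2. symmetry.
  apply (RInt_Chasles (V := CV) (fun u => f (u, y)) a b c); apply ex_hintegral; auto.
Qed.

Lemma vintegral_Chasles (f : C -> C) (x a b c : R) :
  (forall u, Rmin a b <= u <= Rmax a b -> holo_at f (x, u)) ->
  (forall u, Rmin b c <= u <= Rmax b c -> holo_at f (x, u)) ->
  vintegral f x a c = (vintegral f x a b + vintegral f x b c)%C.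
Proof.
  intros H1 H2. symmetry.
  apply (RInt_Chasles (V := CV) (fun u => f (x, u)) a b c); apply ex_vintegral; auto.
Qed.

Lemma Cmod_RInt_le_const (F : R -> C) (a b M : R) : a <= b ->
  @ex_RInt C_R_NormedModule F a b ->
  (forall u, a <= u <= b -> Cmod (F u) <= M) ->
  Cmod (@RInt CV F a b) <= (b - a) * M.
Proof.
  intros Hab Hex H. rewrite <- norm_C_R.
  apply (norm_RInt_le_const (V := C_R_NormedModule) F a b); auto.
  - intros u Hu. rewrite norm_C_R. auto.
  - apply (RInt_correct (V := CV)). auto.
Qed.

Lemma Cmod_RInt_le (F : R -> C) (g : R -> R) (a b lg : R) : a <= b ->
  @ex_RInt C_R_NormedModule F a b -> is_RInt g a b lg ->
  (forall u, a <= u <= b -> Cmod (F u) <= g u) ->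
  Cmod (@RInt CV F a b) <= lg.
Proof.
  intros Hab Hex Hg H. rewrite <- norm_C_R.
  apply (norm_RInt_le (V := C_R_NormedModule) F g a b); auto.
  - intros u Hu. rewrite norm_C_R. auto.
  - apply (RInt_correct (V := CV)). auto.
Qed.

Lemma hintegral_swap (f : C -> C) (y a b : R) :
  (forall u, Rmin a b <= u <= Rmax a b -> holo_at f (u, y)) ->
  hintegral f y b a = (- hintegral f y a b)%C.
Proof.
  intros H. apply (is_RInt_unique (V := CV)). apply (is_RInt_swap (V := C_R_NormedModule)).
  apply (RInt_correct (V := CV)). now apply ex_hintegral.
Qed.

Lemma vintegral_swap (f : C -> C) (x c d : R) :
  (forall v, Rmin c d <= v <= Rmax c d -> holo_at f (x, v)) ->
  vintegral f x d c = (- vintegral f x c d)%C.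
Proof.
  intros H. apply (is_RInt_unique (V := CV)). apply (is_RInt_swap (V := C_R_NormedModule)).
  apply (RInt_correct (V := CV)). now apply ex_vintegral.
Qed.

Lemma Cmod_RInt_le_abs (F : R -> C) (a b M : R) :
  @ex_RInt C_R_NormedModule F a b ->
  (forall u, Rmin a b <= u <= Rmax a b -> Cmod (F u) <= M) ->
  Cmod (@RInt CV F a b) <= Rabs (b - a) * M.
Proof.
  intros Hex H. destruct (Rle_lt_dec a b) as [L|L].
  - rewrite Rabs_pos_eq by lra. apply Cmod_RInt_le_const; auto.
    intros u Hu. apply H. now simpl_minmax.
  - assert (Hex' : @ex_RInt C_R_NormedModule F b a) by now apply ex_RInt_swap.
    replace (@RInt CV F a b) with (- @RInt CV F b a)%C.
    + rewrite Cmod_opp, Rabs_left by lra. replace (- (b - a)) with (a - b) by ring.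
      apply Cmod_RInt_le_const; auto; [lra|].
      intros u Hu. apply H. rewrite Rmin_right, Rmax_left; lra.
    + symmetry. apply (is_RInt_unique (V := CV)). apply (is_RInt_swap (V := C_R_NormedModule)).
      now apply (RInt_correct (V := CV)).
Qed.

Lemma RInt_minus_const (F : R -> C) (a b : R) (c : C) :
  @ex_RInt C_R_NormedModule F a b ->
  @RInt CV (fun u => (F u - c)%C) a b = (@RInt CV F a b - RtoC (b - a) * c)%C.
Proof.
  intros Hex. etransitivity.
  - apply (RInt_minus (V := CV) F (fun _ => c)); auto. apply ex_RInt_const.
  - rewrite <- scal_C_R.
    exact (f_equal (fun d => (@RInt CV F a b - d)%C) (RInt_const (V := CV) a b c)).
Qed.

Lemma ex_RInt_minus_const (F : R -> C) (a b : R) (c : C) :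
  @ex_RInt C_R_NormedModule F a b ->
  @ex_RInt C_R_NormedModule (fun u => (F u - c)%C) a b.
Proof.
  intros Hex. apply (ex_RInt_minus (V := C_R_NormedModule) F (fun _ => c)); auto.
  apply ex_RInt_const.
Qed.

(** The integral of [f dz] along the boundary of [[a, b] x [c, d]], counterclockwise. *)
Definition bdry (f : C -> C) (a b c d : R) : C :=
  (hintegral f c a b + Ci * vintegral f b c d - hintegral f d a b - Ci * vintegral f a c d)%C.

Definition holo_rect (f : C -> C) (a b c d : R) : Prop :=
  forall x y, a <= x <= b -> c <= y <= d -> holo_at f (x, y).

Lemma bdry_split (f : C -> C) (a m b c n d : R) :
  a <= m <= b -> c <= n <= d -> holo_rect f a b c d ->
  bdry f a b c d = (bdry f a m c n + bdry f m b c n + bdry f a m n d + bdry f m b n d)%C.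
Proof.
  intros Hm Hn H. unfold bdry.
  rewrite (hintegral_Chasles f c a m b), (hintegral_Chasles f d a m b),
    (vintegral_Chasles f a c n d), (vintegral_Chasles f b c n d);
  try (intros u Hu; simpl_minmax; apply H; lra). ring.
Qed.

Lemma bdry_le (f : C -> C) (a b c d M : R) : a <= b -> c <= d ->
  holo_rect f a b c d ->
  (forall x y, a <= x <= b -> c <= y <= d -> Cmod (f (x, y)) <= M) ->
  Cmod (bdry f a b c d) <= 2 * ((b - a) + (d - c)) * M.
Proof.
  intros Hab Hcd H HM. unfold bdry.
  assert (H1 : forall y, c <= y <= d -> Cmod (hintegral f y a b) <= (b - a) * M).
  { intros y Hy. apply Cmod_RInt_le_const; auto.
    apply ex_hintegral. intros u Hu; simpl_minmax. apply H; lra. }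
  assert (H2 : forall x, a <= x <= b -> Cmod (Ci * vintegral f x c d) <= (d - c) * M).
  { intros x Hx. rewrite Cmod_mult, Cmod_Ci, Rmult_1_l. apply Cmod_RInt_le_const; auto.
    apply ex_vintegral. intros u Hu; simpl_minmax. apply H; lra. }
  pose proof (Cmod_minus_le (hintegral f c a b + Ci * vintegral f b c d - hintegral f d a b)
    (Ci * vintegral f a c d)).
  pose proof (Cmod_minus_le (hintegral f c a b + Ci * vintegral f b c d) (hintegral f d a b)).
  pose proof (Cmod_triangle (hintegral f c a b) (Ci * vintegral f b c d)).
  pose proof (H1 c ltac:(lra)). pose proof (H1 d ltac:(lra)).
  pose proof (H2 a ltac:(lra)). pose proof (H2 b ltac:(lra)). lra.
Qed.

Lemma bdry_minus (f g : C -> C) (a b c d : R) : a <= b -> c <= d ->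
  holo_rect f a b c d -> holo_rect g a b c d ->
  bdry (fun z => f z - g z)%C a b c d = (bdry f a b c d - bdry g a b c d)%C.
Proof.
  intros Hab Hcd Hf Hg. unfold bdry.
  assert (H1 : forall y, c <= y <= d ->
    hintegral (fun z => f z - g z)%C y a b = (hintegral f y a b - hintegral g y a b)%C).
  { intros y Hy. apply (RInt_minus (V := CV) (fun u => f (u, y)) (fun u => g (u, y)));
    apply ex_hintegral; intros u Hu; simpl_minmax; [apply Hf|apply Hg]; lra. }
  assert (H2 : forall x, a <= x <= b ->
    vintegral (fun z => f z - g z)%C x c d = (vintegral f x c d - vintegral g x c d)%C).
  { intros x Hx. apply (RInt_minus (V := CV) (fun u => f (x, u)) (fun u => g (x, u)));
    apply ex_vintegral; intros u Hu; simpl_minmax; [apply Hf|apply Hg]; lra. }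
  rewrite (H1 c), (H1 d), (H2 a), (H2 b) by lra. ring.
Qed.

(** Each side contributes the increment of the primitive, and the four increments cancel. *)
Lemma bdry_primitive (F f : C -> C) (a b c d : R) : a <= b -> c <= d ->
  (forall z, Cderiv F z (f z)) -> (forall z, holo_at f z) -> bdry f a b c d = 0.
Proof.
  intros Hab Hcd HF Hf. unfold bdry.
  assert (H1 : forall y, hintegral f y a b = (F (b, y) - F (a, y))%C).
  { intros y. apply (is_RInt_unique (V := CV)).
    apply (is_RInt_derive (V := CV) (fun u => F (u, y)) (fun u => f (u, y))).
    - intros u Hu. apply Cderiv_horizontal, HF.
    - intros u Hu. apply holo_continuous_horizontal, Hf. }
  assert (H2 : forall x, (Ci * vintegral f x c d)%C = (F (x, d) - F (x, c))%C).
  { intros x.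
    assert (E : vintegral f x c d = (Copp Ci * F (x, d) - Copp Ci * F (x, c))%C).
    2:{ rewrite E. destruct (F (x, d)), (F (x, c)).
        unfold Ci, Cmult, Cminus, Copp, Cplus; simpl. f_equal; ring. }
    apply (is_RInt_unique (V := CV)).
    apply (is_RInt_derive (V := CV) (fun u => Copp Ci * F (x, u))%C (fun u => f (x, u))).
    - intros u Hu.
      replace (f (x, u)) with (Ci * (0 * F (x, u) + Copp Ci * f (x, u)))%C.
      + apply (Cderiv_vertical (fun z => Copp Ci * F z)%C).
        apply (Cderiv_mult (fun _ => Copp Ci) F). apply Cderiv_const. apply HF.
      + destruct (f (x, u)) as [p q]. unfold Ci, Cmult, Copp, Cplus, RtoC; simpl. f_equal; ring.
    - intros u Hu. apply holo_continuous_vertical, Hf. }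
  rewrite (H1 c), (H1 d), (H2 a), (H2 b). ring.
Qed.

Lemma nested_intervals (u v : nat -> R) :
  (forall n, u n <= u (S n)) -> (forall n, v (S n) <= v n) -> (forall n, u n <= v n) ->
  exists x, forall n, u n <= x <= v n.
Proof.
  intros Hu Hv Huv.
  assert (Iu : forall n k, u n <= u (n + k)%nat).
  { intros n k; induction k; [rewrite Nat.add_0_r; lra|].
    rewrite Nat.add_succ_r. specialize (Hu (n + k)%nat). lra. }
  assert (Iv : forall n k, v (n + k)%nat <= v n).
  { intros n k; induction k; [rewrite Nat.add_0_r; lra|].
    rewrite Nat.add_succ_r. specialize (Hv (n + k)%nat). lra. }
  assert (B : forall n m, u n <= v m).
  { intros n m. pose proof (Iu n m). pose proof (Iv m n). pose proof (Huv (n + m)%nat).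
    rewrite (Nat.add_comm m n) in *. lra. }
  destruct (completeness (fun x => exists n, x = u n)) as [x [Hx1 Hx2]].
  - exists (v O). intros y [n ->]. apply B.
  - exists (u O). now exists O.
  - exists x. intros n. split.
    + apply Hx1. now exists n.
    + apply Hx2. intros y [m ->]. apply B.
Qed.

(** Bisection: some quarter of each rectangle carries at least a quarter of the boundary
    integral, so the [n]-th rectangle of the sequence carries at least [kappa / 4 ^ n]. *)
Section Bisection.
Variables (f : C -> C) (a0 c0 w0 h0 kappa : R).

(** The lower left corner of the first quarter of the [n]-th rectangle, whose corner is
    [p], that carries enough of the boundary integral, or of the last quarter if the first
    three do not. *)
Definition quarter (n : nat) (p : R * R) : R * R :=
  let w := w0 / 2 ^ S n in let h := h0 / 2 ^ S n in
  let (a, c) := p in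
  let big a c := Rle_dec (kappa / 4 ^ S n) (Cmod (bdry f a (a + w) c (c + h))) in
  if big a c then (a, c) else if big (a + w) c then (a + w, c)
  else if big a (c + h) then (a, c + h) else (a + w, c + h).

Fixpoint corner (n : nat) : R * R :=
  match n with O => (a0, c0) | S n => quarter n (corner n) end.

Hypothesis Hw : 0 <= w0.
Hypothesis Hh : 0 <= h0.
Hypothesis Hf : holo_rect f a0 (a0 + w0) c0 (c0 + h0).
Hypothesis Hk : kappa <= Cmod (bdry f a0 (a0 + w0) c0 (c0 + h0)).

Lemma half_pow (x : R) (n : nat) : x / 2 ^ n = x / 2 ^ S n + x / 2 ^ S n.
Proof. simpl. field. apply pow_nonzero; lra. Qed.

Lemma corner_spec (n : nat) :
  let (a, c) := corner n in
  a0 <= a /\ a + w0 / 2 ^ n <= a0 + w0 /\ c0 <= c /\ c + h0 / 2 ^ n <= c0 + h0 /\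
  kappa / 4 ^ n <= Cmod (bdry f a (a + w0 / 2 ^ n) c (c + h0 / 2 ^ n)).
Proof.
  induction n as [|n IH].
  - simpl. rewrite !Rdiv_1_r. repeat split; try lra.
  - simpl corner. destruct (corner n) as [a c]. destruct IH as [A1 [A2 [A3 [A4 A5]]]].
    rewrite (half_pow w0 n) in A2, A5. rewrite (half_pow h0 n) in A4, A5.
    assert (W : 0 <= w0 / 2 ^ S n).
    { apply Rdiv_le_0_compat; auto. apply pow_lt; lra. }
    assert (H : 0 <= h0 / 2 ^ S n).
    { apply Rdiv_le_0_compat; auto. apply pow_lt; lra. }
    assert (K : kappa / 4 ^ n = 4 * (kappa / 4 ^ S n)).
    { simpl. field. apply pow_nonzero; lra. }
    unfold quarter. set (w := w0 / 2 ^ S n) in *. set (h := h0 / 2 ^ S n) in *.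
    set (k := kappa / 4 ^ S n) in *.
    destruct (Rle_dec k _) as [B1|B1]; [repeat split; lra|].
    destruct (Rle_dec k _) as [B2|B2]; [repeat split; lra|].
    destruct (Rle_dec k _) as [B3|B3]; [repeat split; lra|].
    repeat split; try lra.
    rewrite (bdry_split f a (a + w) _ c (c + h)) in A5; try lra.
    2:{ intros x y Hx Hy. apply Hf; lra. }
    replace (a + w + w) with (a + (w + w)) in * by ring.
    replace (c + h + h) with (c + (h + h)) in * by ring.
    set (I1 := bdry f a (a + w) c (c + h)) in *.
    set (I2 := bdry f (a + w) (a + (w + w)) c (c + h)) in *.
    set (I3 := bdry f a (a + w) (c + h) (c + (h + h))) in *.
    set (I4 := bdry f (a + w) (a + (w + w)) (c + h) (c + (h + h))) in *.
    pose proof (Cmod_triangle (I1 + I2 + I3) I4). pose proof (Cmod_triangle (I1 + I2) I3).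
    pose proof (Cmod_triangle I1 I2). lra.
Qed.

Lemma corner_step (n : nat) :
  fst (corner n) <= fst (corner (S n)) /\
  fst (corner (S n)) + w0 / 2 ^ S n <= fst (corner n) + w0 / 2 ^ n /\
  snd (corner n) <= snd (corner (S n)) /\
  snd (corner (S n)) + h0 / 2 ^ S n <= snd (corner n) + h0 / 2 ^ n.
Proof.
  simpl corner. destruct (corner n) as [a c].
  rewrite (half_pow w0 n), (half_pow h0 n).
  assert (W : 0 <= w0 / 2 ^ S n).
  { apply Rdiv_le_0_compat; auto. apply pow_lt; lra. }
  assert (H : 0 <= h0 / 2 ^ S n).
  { apply Rdiv_le_0_compat; auto. apply pow_lt; lra. }
  unfold quarter. set (w := w0 / 2 ^ S n) in *. set (h := h0 / 2 ^ S n) in *.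
  repeat destruct Rle_dec; simpl; lra.
Qed.

(** At the common point of the rectangles [f] is affine up to a relative error [eps].
    Affine functions have a primitive and contribute nothing, so the integral over the
    [n]-th boundary is of order [eps / 4 ^ n] and [kappa] is of order [eps]. *)
Lemma bdry_small : kappa <= 0.
Proof.
  destruct (Rle_lt_dec kappa 0) as [|Hpos]; auto. exfalso.
  assert (W : forall n, 0 <= w0 / 2 ^ n).
  { intros n. apply Rdiv_le_0_compat; auto. apply pow_lt; lra. }
  assert (H : forall n, 0 <= h0 / 2 ^ n).
  { intros n. apply Rdiv_le_0_compat; auto. apply pow_lt; lra. }
  destruct (nested_intervals (fun n => fst (corner n)) (fun n => fst (corner n) + w0 / 2 ^ n))
    as [x Hx].
  { intros n; apply corner_step. } { intros n; apply corner_step. }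
  { intros n; specialize (W n); lra. }
  destruct (nested_intervals (fun n => snd (corner n)) (fun n => snd (corner n) + h0 / 2 ^ n))
    as [y Hy].
  { intros n; apply corner_step. } { intros n; apply corner_step. }
  { intros n; specialize (H n); lra. }
  assert (Hxy : holo_at f (x, y)).
  { specialize (Hx O); specialize (Hy O); simpl in Hx, Hy. rewrite Rdiv_1_r in *. apply Hf; lra. }
  destruct Hxy as [l Hl]. pose proof Hl as Hl'. rewrite Cderiv_eps in Hl.
  set (s := w0 + h0). assert (Hs : 0 <= s) by (unfold s; lra).
  set (eps := kappa / (4 * (s * s + 1))).
  assert (Hss : 0 < s * s + 1) by nra.
  assert (Heps : 0 < eps) by (apply Rdiv_lt_0_compat; lra).
  destruct (Hl eps Heps) as [d [Hd Hl1]].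
  destruct (pow_lt_1_zero (/ 2) ltac:(rewrite Rabs_pos_eq; lra) (d / (s + 1))) as [n Hn].
  { apply Rdiv_lt_0_compat; lra. }
  specialize (Hn n (le_n n)). rewrite Rabs_pos_eq in Hn by (apply pow_le; lra).
  rewrite pow_inv in Hn.
  assert (P2 : 0 < 2 ^ n) by (apply pow_lt; lra).
  assert (Hsd : s / 2 ^ n < d).
  { apply Rle_lt_trans with ((s + 1) * / 2 ^ n).
    - unfold Rdiv. apply Rmult_le_compat_r; [left; apply Rinv_0_lt_compat; auto|lra].
    - replace d with ((s + 1) * (d / (s + 1))) by (field; lra).
      apply Rmult_lt_compat_l; lra. }
  pose proof (corner_spec n) as Hc. specialize (Hx n); specialize (Hy n).
  specialize (W n); specialize (H n).
  destruct (corner n) as [a c]; simpl in Hx, Hy. destruct Hc as [A1 [A2 [A3 [A4 A5]]]].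
  set (z0 := (x, y)) in *.
  (* the affine part of [f] at [z0] and a primitive of it *)
  set (A := fun z : C => (f z0 + (z - z0) * l)%C).
  set (P := fun z : C => (f z0 * z + (z - z0) * (z - z0) * (/ 2 * l))%C).
  assert (DA : forall z, Cderiv A z l).
  { intros z. unfold A. eapply Cderiv_ext.
    - apply (Cderiv_plus (fun _ => f z0) (fun z => (z - z0) * l)%C); [apply Cderiv_const|].
      apply (Cderiv_mult (fun z => z - z0)%C (fun _ => l)); [|apply Cderiv_const].
      apply (Cderiv_minus (fun z => z) (fun _ => z0)); [apply Cderiv_id|apply Cderiv_const].
    - ring. }
  assert (DP : forall z, Cderiv P z (A z)).
  { intros z. unfold P, A.
    assert (D0 : Cderiv (fun z => z - z0)%C z (1 - 0)%C).
    { apply (Cderiv_minus (fun z => z) (fun _ => z0)); [apply Cderiv_id|apply Cderiv_const]. }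
    eapply Cderiv_ext.
    - apply (Cderiv_plus (fun z => f z0 * z)%C (fun z => (z - z0) * (z - z0) * (/ 2 * l))%C).
      + apply (Cderiv_mult (fun _ => f z0) (fun z => z)); [apply Cderiv_const|apply Cderiv_id].
      + apply (Cderiv_mult (fun z => (z - z0) * (z - z0))%C (fun _ => / 2 * l)%C);
          [|apply Cderiv_const].
        apply (Cderiv_mult (fun z => z - z0)%C (fun z => z - z0)%C); exact D0.
    - field. }
  assert (HA : forall z, holo_at A z) by (intros z; exists l; auto).
  assert (Hr : holo_rect f a (a + w0 / 2 ^ n) c (c + h0 / 2 ^ n)).
  { intros u v Hu Hv. apply Hf; lra. }
  assert (E : bdry (fun z => f z - A z)%C a (a + w0 / 2 ^ n) c (c + h0 / 2 ^ n)
              = bdry f a (a + w0 / 2 ^ n) c (c + h0 / 2 ^ n)).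
  { rewrite bdry_minus; auto; try lra. 2:{ intros u v _ _; apply HA. }
    rewrite (bdry_primitive P A) by (auto; lra). ring. }
  rewrite <- E in A5.
  assert (B : Cmod (bdry (fun z => f z - A z)%C a (a + w0 / 2 ^ n) c (c + h0 / 2 ^ n))
     <= 2 * ((a + w0 / 2 ^ n - a) + (c + h0 / 2 ^ n - c)) * (eps * (s / 2 ^ n))).
  { apply bdry_le; try lra.
    - intros u v Hu Hv. destruct (Hr u v Hu Hv) as [m Hm]. exists (m - l)%C.
      apply (Cderiv_minus f A); auto.
    - intros u v Hu Hv. unfold A.
      assert (Q : Cmod ((u, v) - z0) <= s / 2 ^ n).
      { eapply Rle_trans; [apply Cmod_le_re_im|].
        rewrite Re_minus, Im_minus. unfold z0; simpl.
        assert (Rabs (u - x) <= w0 / 2 ^ n) by (apply Rabs_le; lra).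
        assert (Rabs (v - y) <= h0 / 2 ^ n) by (apply Rabs_le; lra).
        unfold s. replace ((w0 + h0) / 2 ^ n) with (w0 / 2 ^ n + h0 / 2 ^ n) by (field; lra). lra. }
      replace (f (u, v) - (f z0 + ((u, v) - z0) * l))%C
        with (f (u, v) - f z0 - ((u, v) - z0) * l)%C by ring.
      eapply Rle_trans; [apply Hl1; lra|]. apply Rmult_le_compat_l; lra. }
  replace (2 * (a + w0 / 2 ^ n - a + (c + h0 / 2 ^ n - c)) * (eps * (s / 2 ^ n)))
    with (2 * eps * (s * s) * / (4 ^ n)) in B.
  2:{ replace (4 ^ n) with (2 ^ n * 2 ^ n) by (rewrite <- Rpow_mult_distr; f_equal; ring).
      unfold s. field. lra. }
  assert (P4 : 0 < / 4 ^ n) by (apply Rinv_0_lt_compat, pow_lt; lra).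
  assert (F : kappa * / 4 ^ n <= 2 * eps * (s * s) * / 4 ^ n) by (unfold Rdiv in A5; lra).
  apply Rmult_le_reg_r in F; auto.
  assert (G : 4 * eps * (s * s + 1) = kappa) by (unfold eps; field; lra).
  nra.
Qed.
End Bisection.

Lemma goursat (f : C -> C) (a b c d : R) : a <= b -> c <= d ->
  holo_rect f a b c d -> bdry f a b c d = 0.
Proof.
  intros Hab Hcd H. apply Cmod_eq_0.
  pose proof (bdry_small f a c (b - a) (d - c) (Cmod (bdry f a b c d))) as B.
  replace (a + (b - a)) with b in B by ring. replace (c + (d - c)) with d in B by ring.
  specialize (B ltac:(lra) ltac:(lra) H ltac:(lra)).
  pose proof (Cmod_ge_0 (bdry f a b c d)). lra.
Qed.

(** * Mean values and Cauchy's estimate *)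

(** Goursat on [[x, rho] x [- PI, PI]]: by periodicity the horizontal sides cancel, so the
    integral along a vertical period does not depend on [x], and [x] tends to minus
    infinity. In the variable [zeta = log (z - w)] this is Cauchy's formula on circles about
    [z], without an exceptional point to remove. *)
Lemma vintegral_period (k : C -> C) (rho : R) (l : C) :
  (forall z, Re z <= rho -> holo_at k z) ->
  (forall x, k (x, PI) = k (x, - PI)) ->
  (forall eps, 0 < eps -> exists x, x <= rho /\
     forall th, Cmod (k (x, th) - l) <= eps) ->
  vintegral k rho (- PI) PI = (RtoC (2 * PI) * l)%C.
Proof.
  intros Hh Hper Hlim. pose proof PI_RGT_0 as Hpi.
  assert (E : forall eps, 0 < eps ->
    Cmod (vintegral k rho (- PI) PI - RtoC (2 * PI) * l) <= 2 * PI * eps).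
  { intros eps Heps. destruct (Hlim eps Heps) as [x [Hx H]].
    assert (G := goursat k x rho (- PI) PI Hx ltac:(lra)).
    assert (Hr : holo_rect k x rho (- PI) PI).
    { intros u v Hu Hv. apply Hh. simpl. lra. }
    specialize (G Hr). unfold bdry in G.
    assert (Q : hintegral k (- PI) x rho = hintegral k PI x rho).
    { apply (RInt_ext (V := CV)). intros u _. symmetry. apply Hper. }
    rewrite Q in G.
    assert (Q2 : vintegral k rho (- PI) PI = vintegral k x (- PI) PI).
    { set (u := vintegral k rho (- PI) PI) in *. set (v := vintegral k x (- PI) PI) in *.
      replace u with (Copp Ci * (hintegral k PI x rho + Ci * u - hintegral k PI x rho - Ci * v) + v)%C.
      - rewrite G. ring.
      - destruct u, v. unfold Ci, Cmult, Copp, Cplus, Cminus; simpl. unfold Cplus, Copp; simpl.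
        f_equal; ring. }
    rewrite Q2.
    assert (X : @ex_RInt C_R_NormedModule (fun v => k (x, v)) (- PI) PI).
    { apply ex_vintegral. intros u Hu. simpl_minmax. apply Hr; lra. }
    assert (Q3 : (vintegral k x (- PI) PI - RtoC (2 * PI) * l)%C =
      @RInt CV (fun v => (k (x, v) - l)%C) (- PI) PI).
    { rewrite RInt_minus_const by auto. replace (PI - - PI) with (2 * PI) by ring.
      reflexivity. }
    rewrite Q3. replace (2 * PI) with (PI - - PI) by ring.
    apply Cmod_RInt_le_const; [lra| |intros; apply H].
    now apply ex_RInt_minus_const. }
  set (d := (vintegral k rho (- PI) PI - RtoC (2 * PI) * l)%C) in *.
  assert (D : d = 0).
  { apply Cmod_eq_0. destruct (Rle_lt_or_eq_dec 0 (Cmod d) (Cmod_ge_0 d)) as [L|]; [|auto].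
    specialize (E (Cmod d / (4 * PI)) ltac:(apply Rdiv_lt_0_compat; lra)).
    replace (2 * PI * (Cmod d / (4 * PI))) with (Cmod d / 2) in E by (field; lra). lra. }
  replace (vintegral k rho (- PI) PI) with (d + RtoC (2 * PI) * l)%C by (unfold d; ring).
  rewrite D. ring.
Qed.

Lemma Cexp_period (x : R) : Cexp (x, PI) = Cexp (x, - PI).
Proof. unfold Cexp; simpl. rewrite cos_neg, sin_neg, sin_PI. f_equal; ring. Qed.

Lemma exp_le_mono (x y : R) : x <= y -> exp x <= exp y.
Proof. intros [H|H]; [left; now apply exp_increasing|subst; lra]. Qed.

Lemma exists_exp_le (d rho : R) : 0 < d -> exists x, x <= rho /\ exp x < d.
Proof.
  intros Hd. exists (Rmin rho (ln (d / 2))). split; [apply Rmin_l|].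
  apply Rle_lt_trans with (d / 2); [|lra].
  apply Rle_trans with (exp (ln (d / 2))); [apply exp_le_mono, Rmin_r|rewrite exp_ln; lra].
Qed.

(** The angle is measured from the leftmost point of the circle, the one nearest to the
    boundary of a right half-plane. *)
Definition circle (z : C) (r th : R) : C := (z - Cexp (ln r, th))%C.

Lemma Cmod_circle (z : C) (r th : R) : 0 < r -> Cmod (circle z r th - z) = r.
Proof.
  intros Hr. unfold circle. replace (z - Cexp (ln r, th) - z)%C with (- Cexp (ln r, th))%C by ring.
  rewrite Cmod_opp, Cmod_Cexp. simpl. now apply exp_ln.
Qed.

Lemma holo_log_disc (f : C -> C) (z : C) (r : R) : 0 < r ->
  (forall w, Cmod (w - z) <= r -> holo_at f w) ->
  forall zeta, Re zeta <= ln r -> holo_at (fun zeta => f (z - Cexp zeta)%C) zeta.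
Proof.
  intros Hr Hf zeta Hz. apply (holo_comp f (fun zeta => z - Cexp zeta)%C).
  - apply Hf. replace (z - Cexp zeta - z)%C with (- Cexp zeta)%C by ring.
    rewrite Cmod_opp, Cmod_Cexp. rewrite <- (exp_ln r) by auto. now apply exp_le_mono.
  - apply holo_minus; [apply holo_const|apply holo_Cexp].
Qed.

Lemma mean_value (f : C -> C) (z : C) (r : R) : 0 < r ->
  (forall w, Cmod (w - z) <= r -> holo_at f w) ->
  @RInt CV (fun th => f (circle z r th)) (- PI) PI = (RtoC (2 * PI) * f z)%C.
Proof.
  intros Hr Hf.
  apply (vintegral_period (fun zeta => f (z - Cexp zeta)%C) (ln r) (f z)).
  - now apply holo_log_disc.
  - intros x. now rewrite Cexp_period.
  - intros eps Heps.
    assert (Hz : holo_at f z).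
    { apply Hf. replace (z - z)%C with (RtoC 0) by ring. rewrite Cmod_0. lra. }
    destruct (holo_continuous f z Hz eps Heps) as [d [Hd H]].
    destruct (exists_exp_le d (ln r) Hd) as [x [Hx Hxd]].
    exists x; split; auto. intros th. left. apply H.
    replace (z - Cexp (x, th) - z)%C with (- Cexp (x, th))%C by ring.
    now rewrite Cmod_opp, Cmod_Cexp.
Qed.

Lemma ex_RInt_circle (f : C -> C) (z : C) (r : R) (a b : R) : 0 < r ->
  (forall w, Cmod (w - z) <= r -> holo_at f w) ->
  @ex_RInt C_R_NormedModule (fun th => f (circle z r th)) a b.
Proof.
  intros Hr Hf. apply (ex_vintegral (fun zeta => f (z - Cexp zeta)%C)).
  intros v _. apply (holo_log_disc f z r Hr Hf). simpl; lra.
Qed.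

(** For circles that come close to the boundary of a region near which a better bound [b] is
    known. *)
Lemma mean_value_two_arcs (f : C -> C) (z : C) (r th0 S b : R) : 0 < r ->
  0 <= th0 <= PI ->
  (forall w, Cmod (w - z) <= r -> holo_at f w) ->
  (forall th, Cmod (f (circle z r th)) <= S) ->
  (forall th, Rabs th <= th0 -> Cmod (f (circle z r th)) <= b) ->
  PI * Cmod (f z) <= (PI - th0) * S + th0 * b.
Proof.
  intros Hr Ht Hf HS Hb.
  pose proof (mean_value f z r Hr Hf) as E.
  pose proof (fun a b => ex_RInt_circle f z r a b Hr Hf) as X.
  set (F := fun th => f (circle z r th)) in *.
  assert (T : Cmod (@RInt CV F (- PI) PI) <=
    (- th0 - - PI) * S + (th0 - - th0) * b + (PI - th0) * S).
  { rewrite <- (RInt_Chasles (V := CV) F (- PI) th0 PI), <- (RInt_Chasles (V := CV) F (- PI) (- th0) th0);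
      try apply X.
    eapply Rle_trans; [apply Cmod_triangle|]. apply Rplus_le_compat.
    eapply Rle_trans; [apply Cmod_triangle|]. apply Rplus_le_compat.
    - apply Cmod_RInt_le_const; [lra|apply X|intros; apply HS].
    - apply Cmod_RInt_le_const; [lra|apply X|]. intros u Hu. apply Hb. apply Rabs_le; lra.
    - apply Cmod_RInt_le_const; [lra|apply X|intros; apply HS]. }
  rewrite E, Cmod_mult, Cmod_R, Rabs_pos_eq in T by lra. lra.
Qed.

(** The kernel [(f (z - e^zeta) - f z) e^(- zeta)] tends to [- l] as [Re zeta] tends to minus
    infinity; subtracting [f z] replaces the computation of the integral of [e^(- zeta)] and
    costs the factor 2. *)
Lemma cauchy_estimate (f : C -> C) (z l : C) (r M : R) : 0 < r ->
  (forall w, Cmod (w - z) <= r -> holo_at f w) ->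
  (forall w, Cmod (w - z) <= r -> Cmod (f w) <= M) ->
  Cderiv f z l -> Cmod l <= 2 * M / r.
Proof.
  intros Hr Hf HM Hl. pose proof PI_RGT_0 as Hpi.
  set (k := fun zeta => ((f (z - Cexp zeta) - f z) * Cexp (- zeta))%C).
  assert (Hk : forall zeta, Re zeta <= ln r -> holo_at k zeta).
  { intros zeta Hz. unfold k. apply holo_mult.
    - apply holo_minus; [now apply (holo_log_disc f z r)|apply holo_const].
    - apply (holo_comp Cexp (fun w => - w)%C); [apply holo_Cexp|].
      apply holo_opp, holo_id. }
  assert (E : vintegral k (ln r) (- PI) PI = (RtoC (2 * PI) * - l)%C).
  { apply vintegral_period; auto.
    - intros x. unfold k. rewrite Cexp_period. f_equal.
      change (Copp (x, PI)) with (- x, - PI). change (Copp (x, - PI)) with (- x, - - PI).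
      rewrite Ropp_involutive. symmetry. apply Cexp_period.
    - intros eps Heps. pose proof (proj1 (Cderiv_eps f z l) Hl eps Heps) as [d [Hd H]].
      destruct (exists_exp_le d (ln r) Hd) as [x [Hx Hxd]].
      exists x; split; auto. intros th. unfold k. set (zeta := (x, th) : C).
      specialize (H (z - Cexp zeta)%C).
      replace (z - Cexp zeta - z)%C with (- Cexp zeta)%C in H by ring.
      rewrite Cmod_opp, Cmod_Cexp in H. specialize (H Hxd).
      assert (I : (Cexp zeta * Cexp (- zeta))%C = 1).
      { rewrite <- Cexp_plus. replace (zeta + - zeta)%C with (RtoC 0) by ring. apply Cexp_0. }
      replace ((f (z - Cexp zeta) - f z) * Cexp (- zeta) - - l)%C
        with ((f (z - Cexp zeta) - f z - - Cexp zeta * l) * Cexp (- zeta))%C.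
      2:{ transitivity ((f (z - Cexp zeta) - f z) * Cexp (- zeta) + (Cexp zeta * Cexp (- zeta)) * l)%C;
          [ring|rewrite I; ring]. }
      rewrite Cmod_mult, Cmod_Cexp. simpl in H |- *.
      apply Rle_trans with (eps * exp x * exp (- x)).
      + apply Rmult_le_compat_r; [left; apply exp_pos|exact H].
      + rewrite Rmult_assoc, <- exp_plus, Rplus_opp_r, exp_0. lra. }
  assert (B : Cmod (vintegral k (ln r) (- PI) PI) <= (PI - - PI) * (2 * M * / r)).
  { apply Cmod_RInt_le_const; [lra| |].
    - apply ex_vintegral. intros v _. apply Hk. simpl; lra.
    - intros v _. unfold k. rewrite Cmod_mult, Cmod_Cexp. simpl.
      rewrite exp_Ropp, exp_ln by auto.
      apply Rmult_le_compat_r; [left; now apply Rinv_0_lt_compat|].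
      eapply Rle_trans; [apply Cmod_minus_le|].
      assert (Cmod (f (z - Cexp (ln r, v))%C) <= M).
      { apply HM. pose proof (Cmod_circle z r v Hr) as Q. unfold circle in Q. lra. }
      assert (Cmod (f z) <= M).
      { apply HM. replace (z - z)%C with (RtoC 0) by ring. rewrite Cmod_0. lra. }
      lra. }
  rewrite E, Cmod_mult, Cmod_R, Rabs_pos_eq, Cmod_opp in B by lra.
  apply Rmult_le_reg_l with (2 * PI); [lra|]. unfold Rdiv. lra.
Qed.

(** Cauchy's estimate on discs of radius [x0 / 2] bounds the derivative on [Re z >= x0],
    which is convex. *)
Lemma lipschitz_of_bounded (f : C -> C) (x0 M : R) : 0 < x0 ->
  (forall z, 0 < Re z -> holo_at f z) ->
  (forall z, x0 / 2 <= Re z -> Cmod (f z) <= M) ->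
  forall z w, x0 <= Re z -> x0 <= Re w -> Cmod (f w - f z) <= 4 * M / x0 * Cmod (w - z).
Proof.
  intros Hx0 Hf HM z w Hz Hw.
  set (D := 4 * M / x0).
  assert (HD : forall v l, x0 <= Re v -> Cderiv f v l -> Cmod l <= D).
  { intros v l Hv Hl. unfold D. replace (4 * M / x0) with (2 * M / (x0 / 2)) by (field; lra).
    assert (B : forall u, Cmod (u - v) <= x0 / 2 -> x0 / 2 <= Re u).
    { intros u Hu. pose proof (re_le_Cmod (u - v)) as Q. rewrite Re_minus in Q.
      pose proof (proj1 (Rabs_le_between _ _) (Rle_trans _ _ _ Q Hu)). lra. }
    apply (cauchy_estimate f v); auto; [lra|].
    intros u Hu. apply Hf. specialize (B u Hu). lra. }
  (* the mean value theorem for the component of [f] in the direction of [f w - f z] *)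
  set (g := fun s : R => (z + RtoC s * (w - z))%C).
  set (u := (f w - f z)%C).
  set (h := fun s : R => Re (Cconj u * f (g s))%C).
  assert (Rg : forall s, 0 <= s <= 1 -> x0 <= Re (g s)).
  { intros s Hs. unfold g. rewrite Re_plus, Re_mult_R, Re_minus. nra. }
  assert (Dh : forall s l, Cderiv f (g s) l ->
    is_derive h s (Re (Cconj u * (l * (w - z)))%C)).
  { intros s l Hl. rewrite Cderiv_eps in Hl. split; [apply is_linear_scal_l|].
    intros s' Hs'. apply (is_filter_lim_locally_unique (V := AbsRing_NormedModule R_AbsRing) s s') in Hs'.
    subst s'. intros eps.
    set (K := (Cmod u + 1) * (Cmod (w - z) + 1)).
    assert (HK : 0 < K).
    { unfold K. pose proof (Cmod_ge_0 u). pose proof (Cmod_ge_0 (w - z)). nra. }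
    destruct (Hl (eps / K)) as [d [Hd H]].
    { apply Rdiv_lt_0_compat; [apply cond_pos|auto]. }
    assert (Hd' : 0 < d / (Cmod (w - z) + 1)).
    { apply Rdiv_lt_0_compat; auto. pose proof (Cmod_ge_0 (w - z)); lra. }
    exists (mkposreal _ Hd'). intros v Hv.
    change (Rabs (v - s) < d / (Cmod (w - z) + 1)) in Hv.
    change (Rabs (h v - h s - (v - s) * Re (Cconj u * (l * (w - z)))) <= eps * Rabs (v - s)).
    assert (G : (g v - g s = RtoC (v - s) * (w - z))%C).
    { unfold g. rewrite RtoC_minus. ring. }
    assert (Gm : Cmod (g v - g s) = Rabs (v - s) * Cmod (w - z)).
    { rewrite G, Cmod_mult, Cmod_R. reflexivity. }
    pose proof (Cmod_ge_0 (w - z)) as Hwz. pose proof (Cmod_ge_0 u) as Hu.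
    pose proof (Rabs_pos (v - s)) as Hvs.
    specialize (H (g v)). rewrite Gm in H.
    assert (Hlt : Rabs (v - s) * Cmod (w - z) < d).
    { apply Rle_lt_trans with (Rabs (v - s) * (Cmod (w - z) + 1)); [nra|].
      replace d with (d / (Cmod (w - z) + 1) * (Cmod (w - z) + 1)) by (field; lra).
      apply Rmult_lt_compat_r; lra. }
    specialize (H Hlt). rewrite G in H.
    replace (h v - h s - (v - s) * Re (Cconj u * (l * (w - z))))
      with (Re (Cconj u * (f (g v) - f (g s) - RtoC (v - s) * (w - z) * l))%C).
    2:{ unfold h. rewrite <- !Re_mult_R, <- !Re_minus. f_equal. ring. }
    eapply Rle_trans; [apply re_le_Cmod|]. rewrite Cmod_mult, Cmod_conj.
    apply Rle_trans with (Cmod u * (eps / K * (Rabs (v - s) * Cmod (w - z)))).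
    { apply Rmult_le_compat_l; auto. }
    replace (pos eps * Rabs (v - s)) with (K * (eps / K * Rabs (v - s))) by (field; lra).
    replace (Cmod u * (eps / K * (Rabs (v - s) * Cmod (w - z))))
      with (Cmod u * Cmod (w - z) * (eps / K * Rabs (v - s))) by ring.
    apply Rmult_le_compat_r.
    - apply Rmult_le_pos; auto. left. apply Rdiv_lt_0_compat; [apply cond_pos|auto].
    - unfold K. nra. }
  assert (Ex : forall s, 0 <= s <= 1 -> exists l, Cderiv f (g s) l).
  { intros s Hs. apply Hf. specialize (Rg s Hs). lra. }
  destruct (MVT_gen h 0 1 (Derive h)) as [c [Hc E]].
  { intros s Hs. simpl_minmax. destruct (Ex s ltac:(lra)) as [l Hl].
    apply Derive_correct. eexists. exact (Dh s l Hl). }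
  { intros s Hs. simpl_minmax. destruct (Ex s ltac:(lra)) as [l Hl].
    apply continuity_pt_filterlim. apply (ex_derive_continuous h). eexists. exact (Dh s l Hl). }
  simpl_minmax. destruct (Ex c ltac:(lra)) as [l Hl]. rewrite (is_derive_unique _ _ _ (Dh c l Hl)) in E.
  assert (G0 : g 0 = z) by (unfold g; ring). assert (G1 : g 1 = w) by (unfold g; ring).
  unfold h in E. rewrite G0, G1 in E. rewrite <- Re_minus in E.
  replace (Cconj u * f w - Cconj u * f z)%C with (u * Cconj u)%C in E by (unfold u; ring).
  rewrite <- Cmod2_conj in E.
  assert (E2 : Cmod u ^ 2 = Re (Cconj u * (l * (w - z)))%C).
  { rewrite Rminus_0_r, Rmult_1_r in E. rewrite <- E. reflexivity. }
  assert (L : Cmod u * Cmod u <= Cmod u * (D * Cmod (w - z))).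
  { replace (Cmod u * Cmod u) with (Cmod u ^ 2) by ring. rewrite E2.
    eapply Rle_trans; [apply Rle_abs|]. eapply Rle_trans; [apply re_le_Cmod|].
    rewrite !Cmod_mult, Cmod_conj. apply Rmult_le_compat_l; [apply Cmod_ge_0|].
    apply Rmult_le_compat_r; [apply Cmod_ge_0|]. apply (HD (g c)); [apply Rg; lra|exact Hl]. }
  destruct (Rle_lt_or_eq_dec 0 (Cmod u) (Cmod_ge_0 u)) as [P|P].
  - now apply Rmult_le_reg_l in L.
  - rewrite <- P. apply Rmult_le_pos; [|apply Cmod_ge_0].
    apply Rle_trans with (Cmod l); [apply Cmod_ge_0|]. apply (HD (g c)); [apply Rg; lra|exact Hl].
Qed.

(** * A maximum principle for the half-plane *)

Lemma one_sub_cos_le (th : R) : 1 - cos th <= Rabs th.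
Proof.
  pose proof (bounded_variation cos (fun x => - sin x) 1 0 th) as B.
  rewrite cos_0, Rminus_0_r, Rmult_1_l in B.
  assert (H : Rabs (cos th - 1) <= Rabs th).
  { apply B. intros t _. split; [apply is_derive_Reals, derivable_pt_lim_cos|].
    rewrite Rabs_Ropp. apply Rabs_le. pose proof (SIN_bound t). lra. }
  pose proof (Rle_abs (- (cos th - 1))). rewrite Rabs_Ropp in H0. lra.
Qed.

Lemma le_one_of_le_exp (y c : R) : (forall d, 0 < d -> y <= exp (c * d)) -> y <= 1.
Proof.
  intros H. destruct (Rle_lt_dec y 1) as [|L]; auto.
  assert (Hl : 0 < ln y) by (rewrite <- ln_1; apply ln_increasing; lra).
  set (d := ln y / (2 * (Rabs c + 1))).
  pose proof (Rabs_pos c) as Hc.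
  assert (Hd : 0 < d) by (apply Rdiv_lt_0_compat; lra).
  specialize (H d Hd).
  assert (H2 : c * d < ln y).
  { apply Rle_lt_trans with (Rabs c * d).
    - apply Rmult_le_compat_r; [lra|apply Rle_abs].
    - replace (ln y) with (2 * (Rabs c + 1) * d) by (unfold d; field; lra). nra. }
  apply exp_increasing in H2. rewrite exp_ln in H2 by lra. lra.
Qed.

(** The decay confines the search for the supremum [S] to a strip [Re z <= X]. There the
    circle about [z] that almost touches the imaginary axis has at least a fixed fraction [p]
    of its length in the strip [Re w <= 2 eps], where [Cmod (f w) <= b]; hence
    [S <= (1 - p) S + p b], that is [S <= b]. *)
Lemma max_principle_decay (f : C -> C) (K delta c : R) : 0 < delta -> 0 <= c ->
  (forall z, 0 < Re z -> holo_at f z) ->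
  (forall z, 0 < Re z -> Cmod (f z) <= K * exp (- (delta * Re z))) ->
  (forall z, 0 < Re z -> Cmod (f z) <= exp (c * Re z)) ->
  forall z, 0 < Re z -> Cmod (f z) <= 1.
Proof.
  intros Hdelta Hc Hf HK Hexp.
  assert (HK0 : 0 <= K).
  { assert (R1 : 0 < Re (RtoC 1)) by (rewrite Re_RtoC; lra).
    pose proof (HK (RtoC 1) R1) as Q. pose proof (Cmod_ge_0 (f (RtoC 1))).
    pose proof (exp_pos (- (delta * Re (RtoC 1)))).
    destruct (Rle_lt_dec 0 K); auto. nra. }
  assert (main : forall eps, 0 < eps -> forall z, 0 < Re z -> Cmod (f z) <= exp (2 * c * eps)).
  2:{ intros z Hz. apply (le_one_of_le_exp _ (2 * c)). intros d Hd. now apply main. }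
  intros eps Heps.
  set (b := exp (2 * c * eps)).
  assert (Hb : 1 <= b).
  { unfold b. rewrite <- exp_0. apply exp_le_mono. nra. }
  assert (HKb : forall z, 0 < Re z -> Cmod (f z) <= K).
  { intros z Hz. eapply Rle_trans; [now apply HK|].
    rewrite <- (Rmult_1_r K) at 2. apply Rmult_le_compat_l; auto.
    rewrite <- exp_0. apply exp_le_mono. nra. }
  destruct (completeness (fun y => exists z, 0 < Re z /\ y = Cmod (f z))) as [S [HS1 HS2]].
  { exists K. intros y [z [Hz ->]]. now apply HKb. }
  { exists (Cmod (f (RtoC 1))), (RtoC 1). split; auto. rewrite Re_RtoC; lra. }
  assert (HS : forall z, 0 < Re z -> Cmod (f z) <= S).
  { intros z Hz. apply HS1. eauto. }
  enough (S <= b) by (intros z Hz; specialize (HS z Hz); lra).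
  destruct (Rle_lt_dec S b) as [|L]; auto. exfalso.
  set (X := (K + 1) / delta).
  assert (HX : 0 < X) by (apply Rdiv_lt_0_compat; lra).
  set (th0 := Rmin 1 (eps / X)).
  assert (Ht1 : th0 <= 1) by apply Rmin_l. assert (Ht2 : th0 <= eps / X) by apply Rmin_r.
  assert (Ht : 0 < th0).
  { apply Rmin_pos; [lra|]. apply Rdiv_lt_0_compat; lra. }
  clearbody th0.
  pose proof PI2_1 as Hpi.
  set (p := th0 / PI).
  assert (Hp : 0 < p) by (apply Rdiv_lt_0_compat; lra).
  assert (Hp1 : p <= 1).
  { apply Rmult_le_reg_r with PI; [lra|]. unfold p, Rdiv. rewrite Rmult_assoc, Rinv_l; lra. }
  assert (B : forall z, 0 < Re z -> Cmod (f z) <= (1 - p) * S + p * b).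
  { intros z Hz.
    destruct (Rle_lt_dec (Re z) (2 * eps)) as [H1|H1].
    { apply Rle_trans with b; [|nra]. eapply Rle_trans; [now apply Hexp|].
      apply exp_le_mono. nra. }
    destruct (Rle_lt_dec X (Re z)) as [H2|H2].
    { apply Rle_trans with b; [|nra]. apply Rle_trans with 1; auto.
      eapply Rle_trans; [now apply HK|].
      assert (E : exp (K + 1) <= exp (delta * Re z)).
      { apply exp_le_mono. replace (K + 1) with (delta * X) by (unfold X; field; lra).
        apply Rmult_le_compat_l; lra. }
      pose proof (exp_ineq1_le (K + 1)).
      rewrite exp_Ropp. apply Rmult_le_reg_r with (exp (delta * Re z)); [apply exp_pos|].
      rewrite Rmult_assoc, Rinv_l; [lra|]. pose proof (exp_pos (delta * Re z)); lra. }
    assert (Hr : 0 < Re z - eps) by lra.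
    assert (Hre : forall w, Cmod (w - z) <= Re z - eps -> 0 < Re w).
    { intros w Hw. pose proof (re_le_Cmod (w - z)) as Q. rewrite Re_minus in Q.
      pose proof (proj1 (Rabs_le_between _ _) (Rle_trans _ _ _ Q Hw)). lra. }
    assert (Hci : forall th, 0 < Re (circle z (Re z - eps) th)).
    { intros th. apply Hre. rewrite Cmod_circle; lra. }
    pose proof (mean_value_two_arcs f z (Re z - eps) th0 S b Hr ltac:(lra)) as M.
    assert (M' : PI * Cmod (f z) <= (PI - th0) * S + th0 * b).
    { apply M.
      - intros w Hw. apply Hf. now apply Hre.
      - intros th. apply HS. apply Hci.
      - intros th Hth. eapply Rle_trans; [apply Hexp, Hci|].
        apply exp_le_mono. replace (2 * c * eps) with (c * (2 * eps)) by ring.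
        apply Rmult_le_compat_l; auto. unfold circle. rewrite Re_minus. simpl.
        rewrite exp_ln by lra.
        pose proof (one_sub_cos_le th) as Q.
        assert ((Re z - eps) * (1 - cos th) <= X * (eps / X)).
        { pose proof (COS_bound th). apply Rmult_le_compat; lra. }
        replace (X * (eps / X)) with eps in H by (field; lra). lra. }
    apply Rmult_le_reg_l with PI; [lra|]. unfold p.
    replace (PI * ((1 - th0 / PI) * S + th0 / PI * b)) with ((PI - th0) * S + th0 * b)
      by (field; lra). lra. }
  assert (S <= (1 - p) * S + p * b).
  { apply HS2. intros y [z [Hz ->]]. now apply B. }
  nra.
Qed.

(** A Phragmen-Lindelof principle: the factor [e^(- d z)] provides decay at infinity and
    disappears as [d] tends to [0]. The bound [exp (c * Re z)] only serves near the imaginary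
    axis, where it says that the boundary values of [f] are at most [1] in modulus. *)
Lemma max_principle_half_plane (f : C -> C) (K c : R) : 0 <= c ->
  (forall z, 0 < Re z -> holo_at f z) ->
  (forall z, 0 < Re z -> Cmod (f z) <= K) ->
  (forall z, 0 < Re z -> Cmod (f z) <= exp (c * Re z)) ->
  forall z, 0 < Re z -> Cmod (f z) <= 1.
Proof.
  intros Hc Hf HK Hexp z Hz.
  apply (le_one_of_le_exp _ (Re z)). intros d Hd.
  set (F := fun w => (f w * Cexp (RtoC (- d) * w))%C).
  assert (HF : forall w, Cmod (F w) = Cmod (f w) * exp (- (d * Re w))).
  { intros w. unfold F. rewrite Cmod_mult, Cmod_Cexp, Re_mult_R. f_equal. f_equal. ring. }
  assert (HF1 : Cmod (F z) <= 1).
  { apply (max_principle_decay F K d c); auto.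
    - intros w Hw. apply holo_mult; auto.
      apply (holo_comp Cexp (fun w => RtoC (- d) * w)%C); [apply holo_Cexp|].
      apply holo_mult; [apply holo_const|apply holo_id].
    - intros w Hw. rewrite HF. apply Rmult_le_compat_r; [left; apply exp_pos|auto].
    - intros w Hw. rewrite HF. rewrite <- (Rmult_1_r (exp (c * Re w))).
      apply Rmult_le_compat; [apply Cmod_ge_0|left; apply exp_pos|auto|].
      rewrite <- exp_0. apply exp_le_mono. nra. }
  rewrite HF, exp_Ropp in HF1. rewrite (Rmult_comm (Re z)).
  pose proof (exp_pos (d * Re z)) as E.
  apply Rmult_le_reg_r with (/ exp (d * Re z)); [now apply Rinv_0_lt_compat|].
  rewrite Rinv_r by lra. exact HF1.
Qed.

(** * Dirichlet series far to the right *)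

Lemma ball_Cmod (l : C) (e : posreal) (w : C) :
  @ball C_UniformSpace l e w -> Cmod (w - l) < 2 * e.
Proof.
  intros [H1 H2].
  change (Rabs (Re w - Re l) < e) in H1. change (Rabs (Im w - Im l) < e) in H2.
  eapply Rle_lt_trans; [apply Cmod_le_re_im|].
  rewrite Re_minus, Im_minus. lra.
Qed.

Lemma is_series_partial_sums (t : nat -> C) (l : C) :
  @is_series C_AbsRing C_NormedModule t l ->
  forall eps, 0 < eps -> exists N, forall n, (N <= n)%nat ->
    Cmod (@sum_n C_AbelianGroup t n - l) < eps.
Proof.
  intros H eps Heps.
  assert (He : 0 < eps / 2) by lra.
  destruct (H (fun w => @ball C_UniformSpace l (eps / 2) w)) as [N HN].
  { exists (mkposreal _ He). intros w Hw; exact Hw. }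
  exists N. intros n Hn. specialize (HN n Hn).
  apply (ball_Cmod l (mkposreal _ He)) in HN. simpl in HN.
  replace (2 * (eps / 2)) with eps in HN by field. exact HN.
Qed.

Lemma sum_n_succ (t : nat -> C) (n : nat) :
  @sum_n C_AbelianGroup t (S n) = (@sum_n C_AbelianGroup t n + t (S n))%C.
Proof. apply (sum_Sn (G := C_AbelianGroup)). Qed.

Lemma is_series_terms_bounded (t : nat -> C) (l : C) :
  @is_series C_AbsRing C_NormedModule t l -> exists B, forall n, Cmod (t n) <= B.
Proof.
  intros H. destruct (is_series_partial_sums t l H 1 Rlt_0_1) as [N HN].
  assert (T : forall n, (S N <= n)%nat -> Cmod (t n) <= 2).
  { intros n Hn. destruct n as [|n]; [lia|].
    pose proof (HN (S n) ltac:(lia)) as H1. pose proof (HN n ltac:(lia)) as H2.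
    rewrite sum_n_succ in H1.
    replace (t (S n)) with ((@sum_n C_AbelianGroup t n + t (S n) - l) -
      (@sum_n C_AbelianGroup t n - l))%C by ring.
    eapply Rle_trans; [apply Cmod_minus_le|]. lra. }
  assert (F : forall M, exists B, forall n, (n < M)%nat -> Cmod (t n) <= B).
  { induction M as [|M [B HB]]; [exists 0; lia|].
    exists (Rmax B (Cmod (t M))). intros n Hn.
    destruct (Nat.eq_dec n M) as [->|Hne]; [apply Rmax_r|].
    eapply Rle_trans; [apply HB; lia|apply Rmax_l]. }
  destruct (F (S N)) as [B HB]. exists (Rmax B 2). intros n.
  destruct (Nat.lt_ge_cases n (S N)) as [L|L].
  - eapply Rle_trans; [now apply HB|apply Rmax_l].
  - eapply Rle_trans; [now apply T|apply Rmax_r].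
Qed.

Lemma Cmod_nat_Cpow_opp (n : nat) (s : C) :
  Cmod (nat_Cpow_opp n s) = exp (- (Re s * ln (INR n))).
Proof.
  unfold nat_Cpow_opp. rewrite Cmod_Cexp. f_equal.
  rewrite Cmult_comm, Re_mult_R, Re_opp. ring.
Qed.

(** The terms of the series are bounded at the real point [s0]; moving to
    [Re z = s0 + 2 + u] gains the factor [n^(-2 - u)], which is at most
    [exp (- u / 2) / (n (n - 1))] for [n >= 2] since [ln 2 > 1 / 2]. *)
Lemma dirichlet_tail (a : nat -> C) (theta : R) :
  dirichlet_converges_on a theta ->
  exists K X, forall z l, X <= Re z -> is_dirichlet_series a z l ->
    Cmod (l - a 1%nat) <= K * exp (- (Re z / 2)).
Proof.
  intros H.
  set (s0 := theta + 1).
  destruct (H (RtoC s0)) as [l0 Hl0].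
  { unfold half_plane. rewrite Re_RtoC. unfold s0; lra. }
  destruct (is_series_terms_bounded _ _ Hl0) as [B HB].
  exists (B * exp ((s0 + 2) / 2)), (s0 + 2). intros z l Hz Hl.
  set (u := Re z - s0 - 2). assert (Hu : 0 <= u) by (unfold u; lra).
  replace (B * exp ((s0 + 2) / 2) * exp (- (Re z / 2))) with (B * exp (- (u / 2))).
  2:{ rewrite Rmult_assoc, <- exp_plus. f_equal. f_equal. unfold u. field. }
  assert (HB0 : 0 <= B).
  { specialize (HB O). pose proof (Cmod_ge_0 (a 1%nat * nat_Cpow_opp 1 (RtoC s0))). lra. }
  set (t := fun n : nat => (a (S n) * nat_Cpow_opp (S n) z)%C) in *.
  assert (T0 : t O = a 1%nat).
  { unfold t, nat_Cpow_opp. simpl INR. rewrite ln_1.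
    replace (- z * RtoC 0)%C with (RtoC 0) by ring. rewrite Cexp_0. ring. }
  pose proof (exp_pos (- (u / 2))) as Hexp.
  assert (Tn : forall n, Cmod (t (S n)) <= B * exp (- (u / 2)) * (/ INR (S n) - / INR (S (S n)))).
  { intros n. specialize (HB (S n)). unfold t.
    rewrite Cmod_mult, Cmod_nat_Cpow_opp in HB |- *. rewrite Re_RtoC in HB.
    set (x := INR (S (S n))) in *.
    assert (Hx : INR (S n) = x - 1) by (unfold x; rewrite (S_INR (S n)); ring).
    assert (Hx2 : 2 <= x).
    { unfold x. rewrite !S_INR. pose proof (pos_INR n). lra. }
    rewrite Hx.
    assert (Hln : / 2 <= ln x).
    { pose proof ln_lt_2. destruct (Req_dec x 2) as [->|]; [lra|].
      pose proof (ln_increasing 2 x ltac:(lra) ltac:(lra)). lra. }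
    replace (- (Re z * ln x)) with (- (s0 * ln x) + (- (u * ln x) + - (2 * ln x)))
      by (unfold u; ring).
    rewrite !exp_plus, <- Rmult_assoc, Rmult_assoc with (r1 := B).
    apply Rmult_le_compat; auto.
    - apply Rmult_le_pos; [apply Cmod_ge_0|left; apply exp_pos].
    - apply Rmult_le_pos; left; apply exp_pos.
    - apply Rmult_le_compat; try (left; apply exp_pos).
      + apply exp_le_mono. nra.
      + replace (exp (- (2 * ln x))) with (/ (x * x)).
        2:{ rewrite exp_Ropp. f_equal. replace (2 * ln x) with (ln x + ln x) by ring.
            rewrite exp_plus, exp_ln; lra. }
        replace (/ (x - 1) - / x) with (/ ((x - 1) * x)) by (field; lra).
        apply Rinv_le_contravar; nra. }
  (* the bounds on the terms telescope *)
  assert (P : forall n, Cmod (@sum_n C_AbelianGroup t n - a 1%nat)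
    <= B * exp (- (u / 2)) * (1 - / INR (S n))).
  { induction n as [|n IH].
    - rewrite sum_O, T0. replace (a 1%nat - a 1%nat)%C with (RtoC 0) by ring.
      rewrite Cmod_0. simpl INR. lra.
    - rewrite sum_n_succ.
      replace (@sum_n C_AbelianGroup t n + t (S n) - a 1%nat)%C with
        ((@sum_n C_AbelianGroup t n - a 1%nat) + t (S n))%C by ring.
      eapply Rle_trans; [apply Cmod_triangle|]. specialize (Tn n). lra. }
  apply Rle_plus_epsilon. intros eps Heps.
  destruct (is_series_partial_sums t l Hl eps Heps) as [N HN].
  specialize (HN N (le_n N)). specialize (P N).
  replace (l - a 1%nat)%C with ((@sum_n C_AbelianGroup t N - a 1%nat)
    - (@sum_n C_AbelianGroup t N - l))%C by ring.
  eapply Rle_trans; [apply Cmod_minus_le|].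
  assert (0 < / INR (S N)) by (apply Rinv_0_lt_compat, lt_0_INR; lia).
  assert (0 <= B * exp (- (u / 2)) * / INR (S N)) by (repeat apply Rmult_le_pos; lra).
  lra.
Qed.

(** * The linear coefficient *)

Lemma expansion_asymptotic (Phi : C -> C) (c : nat) : has_expansion Phi c ->
  exists a K X, 0 < X /\ 0 <= K /\ forall z, X <= Re z ->
    Cmod (Phi z - RtoC (INR c) * z - a) <= K * exp (- (Re z / 2)).
Proof.
  intros [a [theta [Hconv H]]]. destruct (dirichlet_tail a theta Hconv) as [K [X HKX]].
  exists (a 1%nat), (Rabs K), (Rmax 1 (Rmax X (theta + 1))).
  pose proof (Rmax_l 1 (Rmax X (theta + 1))). pose proof (Rmax_r 1 (Rmax X (theta + 1))).
  pose proof (Rmax_l X (theta + 1)). pose proof (Rmax_r X (theta + 1)).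
  split; [lra|]. split; [apply Rabs_pos|]. intros z Hz.
  eapply Rle_trans; [apply (HKX z)|].
  - lra.
  - apply H; unfold half_plane; lra.
  - apply Rmult_le_compat_r; [left; apply exp_pos|apply Rle_abs].
Qed.

Lemma expansion_linear (Phi : C -> C) (c : nat) : has_expansion Phi c ->
  exists A X, 0 < X /\ forall z, X <= Re z -> Cmod (Phi z - RtoC (INR c) * z) <= A.
Proof.
  intros H. destruct (expansion_asymptotic Phi c H) as [a [K [X [HX [HK B]]]]].
  exists (K + Cmod a), X. split; auto. intros z Hz. specialize (B z Hz).
  pose proof (Cmod_le_add (Phi z - RtoC (INR c) * z) a) as T.
  assert (exp (- (Re z / 2)) <= 1) by (rewrite <- exp_0; apply exp_le_mono; lra).
  nra.
Qed.

(** Far to the right [Phi z] is [c z] up to a bounded error, and it stays far to the right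
    because [c] is nonzero; so [Psi z] is [c * c * z] up to a bounded error. *)
Lemma expansion_square (Phi Psi : C -> C) (c c' : nat) :
  (forall z, 0 < Re z -> Phi (Phi z) = Psi z) ->
  has_expansion Phi c -> has_expansion Psi c' -> c <> 0%nat -> c' = (c * c)%nat.
Proof.
  intros Hcomp H H' Hc.
  destruct (expansion_linear Phi c H) as [A [X [HX B]]].
  destruct (expansion_linear Psi c' H') as [A' [X' [HX' B']]].
  destruct (Nat.eq_dec c' (c * c)) as [|Hne]; auto. exfalso.
  set (cr := INR c).
  assert (Hc1 : 1 <= cr) by (apply (le_INR 1); lia).
  assert (HA : 0 <= A).
  { pose proof (Cmod_ge_0 (Phi (RtoC X) - RtoC (INR c) * RtoC X)).
    specialize (B (RtoC X) ltac:(rewrite Re_RtoC; lra)). lra. }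
  assert (HA' : 0 <= A').
  { pose proof (Cmod_ge_0 (Psi (RtoC X') - RtoC (INR c') * RtoC X')).
    specialize (B' (RtoC X') ltac:(rewrite Re_RtoC; lra)). lra. }
  set (x := X + X' + A + (A + cr * A + A') + 1).
  assert (Hcrx : 0 <= cr * A) by nra.
  assert (Hx : 0 < Re (RtoC x)) by (rewrite Re_RtoC; unfold x; lra).
  pose proof (B (RtoC x) ltac:(rewrite Re_RtoC; unfold x; lra)) as B1.
  set (w := Phi (RtoC x)) in *.
  assert (Hw : X <= Re w).
  { pose proof (re_le_Cmod (w - RtoC cr * RtoC x)) as Q.
    rewrite Re_minus, Re_mult_R, Re_RtoC in Q.
    pose proof (proj1 (Rabs_le_between _ _) (Rle_trans _ _ _ Q B1)).
    assert (x <= cr * x) by (rewrite Re_RtoC in Hx; nra). unfold x in *; lra. }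
  pose proof (B w Hw) as B2. unfold w in B2 at 1. rewrite Hcomp in B2 by auto.
  pose proof (B' (RtoC x) ltac:(rewrite Re_RtoC; unfold x; lra)) as B3.
  assert (T : Cmod (RtoC ((cr * cr - INR c') * x)) <= A + cr * A + A').
  { replace (RtoC ((cr * cr - INR c') * x)) with
      ((Psi (RtoC x) - RtoC (INR c') * RtoC x) - (Psi (RtoC x) - RtoC (INR c) * w)
        - RtoC cr * (w - RtoC cr * RtoC x))%C.
    2:{ rewrite !RtoC_mult, RtoC_minus, RtoC_mult. unfold cr. ring. }
    eapply Rle_trans; [apply Cmod_minus_le|].
    pose proof (Cmod_minus_le (Psi (RtoC x) - RtoC (INR c') * RtoC x) (Psi (RtoC x) - RtoC (INR c) * w)).
    rewrite Cmod_mult, Cmod_R, (Rabs_pos_eq cr) by lra. fold cr in B1.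
    assert (cr * Cmod (w - RtoC cr * RtoC x) <= cr * A) by (apply Rmult_le_compat_l; lra).
    lra. }
  rewrite Cmod_R, Rabs_mult, (Rabs_pos_eq x) in T by (unfold x; lra).
  assert (D : 1 <= Rabs (cr * cr - INR c')).
  { unfold cr. rewrite <- mult_INR.
    destruct (Nat.lt_ge_cases c' (c * c)) as [L|L].
    - assert (INR c' + 1 <= INR (c * c)) by (rewrite <- S_INR; apply le_INR; lia).
      rewrite Rabs_pos_eq; lra.
    - assert (INR (c * c) + 1 <= INR c') by (rewrite <- S_INR; apply le_INR; lia).
      rewrite Rabs_left1; lra. }
  assert (0 < x) by (unfold x; lra).
  assert (x <= Rabs (cr * cr - INR c') * x) by nra. unfold x in *; lra.
Qed.

Lemma compact_singleton (z0 : C) : compact_set (fun z => z = z0).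
Proof.
  intros I U _ Hcov. destruct (Hcov z0 eq_refl) as [i Hi].
  exists (i :: nil). intros z ->. exists i. split; [now left|auto].
Qed.

Lemma semigroup_pointwise (Phi : R -> C -> C) (z : C) : continuous_semigroup Phi ->
  half_plane 0 z -> forall eps, 0 < eps -> exists delta, 0 < delta /\
    forall t, 0 < t < delta -> Cmod (Phi t z - z) < eps.
Proof.
  intros HS Hz eps Heps.
  destruct (csg_cont _ HS _ (compact_singleton z) ltac:(intros w ->; auto)
    (mkposreal eps Heps)) as [d Hd].
  exists d. split; [apply cond_pos|]. intros t Ht.
  specialize (Hd t). rewrite <- (csg_id _ HS z Hz) at 2. apply Hd; auto; [|lra].
  change (Rabs (t - 0) < d). rewrite Rabs_pos_eq; lra.
Qed.

Lemma semigroup_double (Phi : R -> C -> C) (t : R) : continuous_semigroup Phi -> 0 < t ->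
  forall z, 0 < Re z -> Phi (t / 2) (Phi (t / 2) z) = Phi t z.
Proof.
  intros HS Ht z Hz. rewrite (csg_comp _ HS) by (auto; lra). f_equal. field.
Qed.

(** If the coefficient vanishes at time [t], it vanishes at all times [t / 2 ^ n]. These maps
    send [1 / 4] into [Re z > 1 / 2], although they tend to the identity at [1 / 4]. *)
Lemma coefficient_nonzero (Phi : R -> C -> C) : continuous_semigroup Phi ->
  (forall t, 0 < t -> class_G (Phi t)) ->
  forall t, 0 < t -> ~ has_expansion (Phi t) 0.
Proof.
  intros HS HG t Ht H0.
  assert (Hp : forall n : nat, 0 < t / 2 ^ n).
  { intros n. apply Rdiv_lt_0_compat; auto. apply pow_lt; lra. }
  assert (H : forall n : nat, has_expansion (Phi (t / 2 ^ n)) 0).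
  { induction n as [|n IH]; [simpl; now rewrite Rdiv_1_r|].
    destruct (HG _ (Hp (S n))) as [[_ [_ [c Hc]]] _].
    destruct (Nat.eq_dec c 0) as [->|Hne]; auto. exfalso.
    assert (E : 0%nat = (c * c)%nat).
    { apply (expansion_square (Phi (t / 2 ^ S n)) (Phi (t / 2 ^ n))); auto.
      intros z Hz. rewrite <- (semigroup_double Phi (t / 2 ^ n)); auto.
      replace (t / 2 ^ n / 2) with (t / 2 ^ S n); auto. simpl. field. apply pow_nonzero; lra. }
    nia. }
  assert (Hq : half_plane 0 (RtoC (/ 4))) by (unfold half_plane; rewrite Re_RtoC; lra).
  destruct (semigroup_pointwise Phi _ HS Hq (/ 4) ltac:(lra)) as [d [Hd B]].
  destruct (pow_lt_1_zero (/ 2) ltac:(rewrite Rabs_pos_eq; lra) (d / t)) as [n Hn].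
  { now apply Rdiv_lt_0_compat. }
  specialize (Hn n (le_n n)). rewrite Rabs_pos_eq in Hn by (apply pow_le; lra).
  rewrite pow_inv in Hn.
  assert (L : t / 2 ^ n < d).
  { replace d with (t * (d / t)) by (field; lra). unfold Rdiv at 1. now apply Rmult_lt_compat_l. }
  specialize (B _ (conj (Hp n) L)).
  destruct (HG _ (Hp n)) as [_ Hhalf]. specialize (Hhalf (H n) _ Hq).
  unfold half_plane in Hhalf.
  pose proof (re_le_Cmod (Phi (t / 2 ^ n) (RtoC (/ 4)) - RtoC (/ 4))) as Q.
  rewrite Re_minus, Re_RtoC in Q.
  pose proof (proj1 (Rabs_le_between _ _) Q). lra.
Qed.

(** Halving the time replaces [c] by a square root; a natural number greater than [1] has
    only finitely many successive integral square roots. *)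
Lemma coefficient_one (Phi : R -> C -> C) : continuous_semigroup Phi ->
  (forall t, 0 < t -> class_G (Phi t)) ->
  forall t, 0 < t -> has_expansion (Phi t) 1.
Proof.
  intros HS HG.
  assert (H : forall n c t, (c <= n)%nat -> 0 < t -> has_expansion (Phi t) c -> c = 1%nat).
  { induction n as [|n IH]; intros c t Hcn Ht Hc.
    - exfalso. apply (coefficient_nonzero Phi HS HG t Ht). now replace 0%nat with c by lia.
    - destruct (HG (t / 2) ltac:(lra)) as [[_ [_ [c' Hc']]] _].
      assert (Hc0 : c' <> 0%nat).
      { intros ->. apply (coefficient_nonzero Phi HS HG (t / 2)); auto; lra. }
      pose proof (expansion_square _ _ c' c (semigroup_double Phi t HS Ht) Hc' Hc Hc0) as E.
      destruct (Nat.eq_dec c' 1) as [->|Hne]; [lia|].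
      assert (c' = 1%nat) by (apply (IH c' (t / 2)); auto; [nia|lra]). lia. }
  intros t Ht. destruct (HG t Ht) as [[_ [_ [c Hc]]] _].
  rewrite <- (H c c t); auto.
Qed.

(** * The drift of a map *)

(** The number [a] is the limit of [Phi z - z] as [Re z] tends to infinity: the constant
    coefficient of the Dirichlet series. The factor [Re z] lets the displacement blow up at the
    imaginary axis. *)
Definition drift (Phi : C -> C) (a : C) : Prop :=
  0 <= Re a /\
  (forall z, 0 < Re z -> 0 <= Re (Phi z - z)%C) /\
  (forall z, 0 < Re z -> Cmod (Phi z - z - a) * Re z <= 4 * Re a).

Lemma exp_tail_small (K X eps : R) : 0 <= K -> 0 < X -> 0 < eps ->
  exists x, X <= x /\ K * exp (- (x / 2)) <= eps.
Proof.
  intros HK HX Heps. exists (X + 2 * (K / eps)).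
  assert (HKe : 0 <= K / eps) by (apply Rdiv_le_0_compat; lra). split; [lra|].
  set (x := X + 2 * (K / eps)).
  assert (H : K / eps <= exp (x / 2)).
  { pose proof (exp_ineq1_le (x / 2)). unfold x in *. lra. }
  rewrite exp_Ropp. pose proof (exp_pos (x / 2)) as P.
  apply Rmult_le_reg_r with (exp (x / 2)); auto. rewrite Rmult_assoc, Rinv_l by lra.
  replace (K * 1) with (eps * (K / eps)) by (field; lra). apply Rmult_le_compat_l; lra.
Qed.

Lemma le_zero_of_le_eps (y : R) (k : R) : (forall e, 0 < e -> y <= k * e) -> y <= 0.
Proof.
  intros H. destruct (Rle_lt_dec y 0) as [|L]; auto.
  pose proof (Rabs_pos k). pose proof (Rle_abs k).
  set (e := y / (2 * (Rabs k + 1))).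
  assert (He : 0 < e) by (apply Rdiv_lt_0_compat; lra).
  specialize (H e He).
  assert (y = 2 * (Rabs k + 1) * e) by (unfold e; field; lra). nra.
Qed.

(** The point [p] lies on the same side of the imaginary axis as [a], hence is closer to [a]
    than to the mirror image [- Cconj a] of [a]; the shift by [2 * e] keeps the right-hand side
    away from [0]. *)
Lemma Cmod_reflect_le (p a : C) (e : R) : 0 <= Re p -> 0 <= Re a -> 0 < e ->
  Cmod (p - a) <= Cmod (p + Cconj a + RtoC (2 * e)) /\
  2 * e <= Cmod (p + Cconj a + RtoC (2 * e)).
Proof.
  intros Hp Ha He. destruct p as [p q], a as [al be]. unfold Re in Hp, Ha; simpl in Hp, Ha. split.
  - unfold Cmod; simpl. apply sqrt_le_1_alt. nra.
  - eapply Rle_trans; [|apply re_le_Cmod]. simpl. rewrite Rabs_pos_eq; lra.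
Qed.

(** Let [phi z = Phi z - z]. The maximum principle for [e^(- phi)], whose modulus is less than
    [e^(Re z)] since [Phi] preserves the half-plane, gives [Re (phi z) >= 0]. As in the Schwarz
    lemma, the quotient [(phi - a) / (phi + Cconj a)] has modulus at most [1], and it is
    [O(e^(- Re z / 2))] at infinity; the maximum principle for its product with [e^(z / 2)]
    bounds it by [e^(- Re z / 2)] everywhere, and the displacement bound follows from
    [e^(x / 2) - 1 >= x / 2]. *)
Lemma expansion_drift (Phi : C -> C) :
  holomorphic_on (half_plane 0) Phi -> maps_into (half_plane 0) (half_plane 0) Phi ->
  has_expansion Phi 1 -> exists a, drift Phi a.
Proof.
  intros Hh Hm Hexp.
  destruct (expansion_asymptotic Phi 1 Hexp) as [a [K [X [HX [HK B]]]]].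
  set (phi := fun z => (Phi z - z)%C).
  assert (Bphi : forall z, X <= Re z -> Cmod (phi z - a) <= K * exp (- (Re z / 2))).
  { intros z Hz. specialize (B z Hz). unfold phi. simpl INR in B.
    replace (Phi z - z - a)%C with (Phi z - RtoC 1 * z - a)%C by ring. exact B. }
  assert (Bphi1 : forall z, X <= Re z -> Cmod (phi z - a) <= K).
  { intros z Hz. eapply Rle_trans; [now apply Bphi|].
    assert (exp (- (Re z / 2)) <= 1) by (rewrite <- exp_0; apply exp_le_mono; lra). nra. }
  assert (Hphi : forall z, 0 < Re z -> holo_at phi z).
  { intros z Hz. apply holo_minus; [|apply holo_id].
    destruct (Hh z Hz) as [l Hl]. exists l. now apply Cderiv_of_is_derive. }
  assert (Pos : forall z, 0 < Re z -> 0 <= Re (phi z)).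
  { intros z Hz.
    assert (N : forall w, Cmod (Cexp (0 - phi w)%C) = exp (- Re (phi w))).
    { intros w. rewrite Cmod_Cexp, Re_minus, Re_RtoC. f_equal. ring. }
    assert (M : Cmod (Cexp (0 - phi z)%C) <= 1).
    { apply (max_principle_half_plane (fun w => Cexp (0 - phi w)%C)
        (exp X + exp (K + Rabs (Re a))) 1); auto; [lra| | |].
      - intros w Hw. apply (holo_comp Cexp (fun w => 0 - phi w)%C); [apply holo_Cexp|].
        apply holo_minus; [apply holo_const|auto].
      - intros w Hw. rewrite N. pose proof (exp_pos X). pose proof (exp_pos (K + Rabs (Re a))).
        destruct (Rle_lt_dec X (Re w)) as [L|L].
        + assert (exp (- Re (phi w)) <= exp (K + Rabs (Re a))); [|lra].
          apply exp_le_mono. pose proof (re_le_Cmod (phi w - a)) as Q. rewrite Re_minus in Q.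
          pose proof (proj1 (Rabs_le_between _ _) (Rle_trans _ _ _ Q (Bphi1 w L))).
          pose proof (Rle_abs (- Re a)). rewrite Rabs_Ropp in *. lra.
        + assert (exp (- Re (phi w)) <= exp X); [|lra].
          apply exp_le_mono. pose proof (Hm w Hw) as P. unfold half_plane in P.
          unfold phi. rewrite Re_minus. lra.
      - intros w Hw. rewrite N. apply exp_le_mono. pose proof (Hm w Hw) as P.
        unfold half_plane in P. unfold phi. rewrite Re_minus. lra. }
    rewrite N in M. destruct (Rle_lt_dec 0 (Re (phi z))) as [|L]; auto.
    pose proof (exp_increasing 0 (- Re (phi z)) ltac:(lra)) as I. rewrite exp_0 in I. lra. }
  assert (Ha : 0 <= Re a).
  { enough (- Re a <= 0) by lra. apply (le_zero_of_le_eps _ 1). intros e He.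
    destruct (exp_tail_small K X e HK HX He) as [x [Hx1 Hx2]].
    specialize (Bphi (RtoC x) ltac:(rewrite Re_RtoC; lra)).
    pose proof (re_le_Cmod (phi (RtoC x) - a)) as Q. rewrite Re_minus in Q.
    pose proof (proj1 (Rabs_le_between _ _) (Rle_trans _ _ _ Q Bphi)).
    rewrite Re_RtoC in *. specialize (Pos (RtoC x) ltac:(rewrite Re_RtoC; lra)). lra. }
  exists a. split; [auto|]. split; [exact Pos|]. intros z Hz. change (Phi z - z)%C with (phi z).
  enough (Cmod (phi z - a) * Re z - 4 * Re a <= 0) by lra.
  apply (le_zero_of_le_eps _ 4). intros e He.
  (* the shift by 2 e keeps the denominator away from 0, even if Re a = 0 *)
  set (d := fun w => (phi w + Cconj a + RtoC (2 * e))%C).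
  assert (Hd : forall w, 0 < Re w -> Cmod (phi w - a) <= Cmod (d w) /\ 2 * e <= Cmod (d w)).
  { intros w Hw. apply Cmod_reflect_le; auto. }
  set (g := fun w => ((phi w - a) / d w * Cexp (RtoC (/ 2) * w))%C).
  assert (Ng : forall w, 0 < Re w -> Cmod (g w) = Cmod (phi w - a) / Cmod (d w) * exp (Re w / 2)).
  { intros w Hw. unfold g. rewrite Cmod_mult, Cmod_div, Cmod_Cexp, Re_mult_R.
    - f_equal. f_equal. field.
    - apply Cmod_gt_0. pose proof (Hd w Hw). lra. }
  assert (Hratio : forall w, 0 < Re w -> 0 <= Cmod (phi w - a) / Cmod (d w) <= 1).
  { intros w Hw. pose proof (Hd w Hw). pose proof (Cmod_ge_0 (phi w - a)). split.
    - apply Rdiv_le_0_compat; lra.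
    - apply Rmult_le_reg_r with (Cmod (d w)); [lra|].
      unfold Rdiv. rewrite Rmult_assoc, Rinv_l; lra. }
  assert (M : Cmod (g z) <= 1).
  { apply (max_principle_half_plane g (exp (X / 2) + K / (2 * e)) (/ 2)); auto; [lra| | |].
    - intros w Hw. apply holo_mult.
      + apply (holo_div (fun w => phi w - a)%C d).
        * apply Cmod_gt_0. pose proof (Hd w Hw). lra.
        * apply holo_minus; [auto|apply holo_const].
        * apply (holo_plus (fun w => phi w + Cconj a)%C (fun _ => RtoC (2 * e)));
            [|apply holo_const].
          apply holo_plus; [auto|apply holo_const].
      + apply (holo_comp Cexp (fun w => RtoC (/ 2) * w)%C); [apply holo_Cexp|].
        apply holo_mult; [apply holo_const|apply holo_id].
    - intros w Hw. rewrite Ng by auto. pose proof (exp_pos (X / 2)).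
      assert (0 <= K / (2 * e)) by (apply Rdiv_le_0_compat; lra).
      pose proof (exp_pos (Re w / 2)) as Pw.
      destruct (Rle_lt_dec X (Re w)) as [L|L].
      + assert (Cmod (phi w - a) / Cmod (d w) * exp (Re w / 2) <= K / (2 * e)); [|lra].
        specialize (Bphi w L). rewrite exp_Ropp in Bphi.
        replace (Cmod (phi w - a) / Cmod (d w) * exp (Re w / 2))
          with ((Cmod (phi w - a) * exp (Re w / 2)) * / Cmod (d w)) by (unfold Rdiv; ring).
        unfold Rdiv. apply Rmult_le_compat.
        * apply Rmult_le_pos; [apply Cmod_ge_0|lra].
        * pose proof (Hd w Hw). left; apply Rinv_0_lt_compat; lra.
        * apply Rmult_le_compat_r with (r := exp (Re w / 2)) in Bphi; [|lra].
          rewrite Rmult_assoc, Rinv_l in Bphi by lra. lra.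
        * apply Rinv_le_contravar; [lra|]. apply (Hd w Hw).
      + specialize (Hratio w Hw).
        assert (exp (Re w / 2) <= exp (X / 2)) by (apply exp_le_mono; lra). nra.
    - intros w Hw. rewrite Ng by auto. specialize (Hratio w Hw).
      pose proof (exp_pos (Re w / 2)) as Pw. replace (/ 2 * Re w) with (Re w / 2) by field. nra. }
  rewrite Ng in M by auto. pose proof (Hd z Hz) as [_ D2].
  pose proof (exp_ineq1_le (Re z / 2)) as E1.
  assert (L1 : Cmod (phi z - a) * exp (Re z / 2) <= Cmod (d z)).
  { apply Rmult_le_reg_r with (/ Cmod (d z)); [apply Rinv_0_lt_compat; lra|].
    rewrite Rinv_r by lra. unfold Rdiv in M. lra. }
  assert (L2 : Cmod (d z) <= Cmod (phi z - a) + (2 * Re a + 2 * e)).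
  { replace (d z) with ((phi z - a) + RtoC (2 * Re a + 2 * e))%C.
    - eapply Rle_trans; [apply Cmod_triangle|]. rewrite Cmod_R, Rabs_pos_eq; lra.
    - unfold d. destruct (phi z) as [p q], a as [al be].
      unfold Cconj, RtoC, Cplus, Cminus, Copp, Re; simpl. unfold Cplus; simpl. f_equal; ring. }
  pose proof (Cmod_ge_0 (phi z - a)). nra.
Qed.

Section Drifts.
Variable Phi : R -> C -> C.
Hypothesis HS : continuous_semigroup Phi.

Lemma drift_add (s u : R) (a b c : C) : 0 < s -> 0 < u ->
  drift (Phi s) a -> drift (Phi u) b -> drift (Phi (s + u)) c -> c = (a + b)%C.
Proof.
  intros Hs Hu [Ha [Pa Da]] [Hb [Pb Db]] [Hc [Pc Dc]].
  set (M := 4 * (Re a + Re b + Re c)).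
  assert (H : forall x, 0 < x -> Cmod (c - (a + b)) * x <= M).
  { intros x Hx.
    assert (Rx : 0 < Re (RtoC x)) by (rewrite Re_RtoC; lra).
    specialize (Db _ Rx). specialize (Dc _ Rx). specialize (Pb _ Rx).
    rewrite <- (csg_comp _ HS) in Dc by (auto; lra).
    set (w := Phi u (RtoC x)) in *.
    rewrite Re_minus in Pb. rewrite Re_RtoC in *.
    specialize (Da w ltac:(lra)).
    assert (Da' : Cmod (Phi s w - w - a) * x <= 4 * Re a).
    { eapply Rle_trans; [|exact Da]. apply Rmult_le_compat_l; [apply Cmod_ge_0|lra]. }
    replace (c - (a + b))%C with ((Phi s w - w - a) + (w - RtoC x - b)
      - (Phi s w - RtoC x - c))%C by ring.
    pose proof (Cmod_minus_le ((Phi s w - w - a) + (w - RtoC x - b)) (Phi s w - RtoC x - c)).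
    pose proof (Cmod_triangle (Phi s w - w - a) (w - RtoC x - b)).
    unfold M. nra. }
  assert (HM : 0 <= M) by (unfold M; lra).
  assert (E : (c - (a + b))%C = 0).
  { apply Cmod_eq_0. destruct (Rle_lt_or_eq_dec _ _ (Cmod_ge_0 (c - (a + b)))) as [L|]; auto.
    specialize (H ((M + 1) / Cmod (c - (a + b))) ltac:(apply Rdiv_lt_0_compat; lra)).
    replace (Cmod (c - (a + b)) * ((M + 1) / Cmod (c - (a + b)))) with (M + 1) in H
      by (field; lra). lra. }
  replace c with (c - (a + b) + (a + b))%C by ring. rewrite E. ring.
Qed.

Hypothesis Hdrift : forall t, 0 < t -> exists a, drift (Phi t) a.

Lemma drift_multiple (s : R) (a : C) (n : nat) (b : C) : 0 < s -> drift (Phi s) a ->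
  drift (Phi (INR (S n) * s)) b -> b = (RtoC (INR (S n)) * a)%C.
Proof.
  intros Hs Ha. revert b. induction n as [|n IH]; intros b Hb.
  - simpl INR in Hb. rewrite Rmult_1_l in Hb.
    destruct (Hdrift (s + s) ltac:(lra)) as [c Hc].
    pose proof (drift_add s s a a c Hs Hs Ha Ha Hc) as E1.
    pose proof (drift_add s s a b c Hs Hs Ha Hb Hc) as E2.
    simpl INR. replace b with ((a + b) - a)%C by ring. rewrite <- E2, E1. ring.
  - assert (Hn : 0 < INR (S n) * s) by (apply Rmult_lt_0_compat; auto; apply lt_0_INR; lia).
    destruct (Hdrift _ Hn) as [c Hc].
    rewrite S_INR in Hb. rewrite Rmult_plus_distr_r, Rmult_1_l in Hb.
    rewrite (drift_add _ _ c a b Hn Hs Hc Ha Hb), (IH c Hc), (S_INR (S n)), RtoC_plus. ring.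
Qed.

(** At the point [8] the drift bound reads [Cmod (Phi 8 - 8 - a) <= Re a / 2], so [a] is at
    most twice the displacement of [8]. *)
Lemma drift_small (eps : R) : 0 < eps -> exists delta, 0 < delta /\
  forall t a, 0 < t < delta -> drift (Phi t) a -> Cmod a <= eps.
Proof.
  intros Heps.
  assert (H8 : half_plane 0 (RtoC 8)) by (unfold half_plane; rewrite Re_RtoC; lra).
  destruct (semigroup_pointwise Phi _ HS H8 (eps / 2) ltac:(lra)) as [d [Hd B]].
  exists d; split; auto. intros t a Ht [Ha [_ Da]].
  specialize (B t Ht). specialize (Da _ H8). rewrite Re_RtoC in Da.
  pose proof (re_le_Cmod a) as Q. rewrite Rabs_pos_eq in Q by auto.
  pose proof (Cmod_le_add a (Phi t (RtoC 8) - RtoC 8)) as T.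
  rewrite (Cmod_minus_sym a) in T. lra.
Qed.
End Drifts.

(** * Path-independent integrals near the imaginary axis *)

(** The primitive of [f] that vanishes at [1]. *)
Definition potential (f : C -> C) (z : C) : C :=
  (hintegral f 0 1 (Re z) + Ci * vintegral f (Re z) 0 (Im z))%C.

Lemma sqrt_sub_le (a d : R) : 0 <= a -> 0 <= d -> sqrt (a + d) - sqrt a <= sqrt d.
Proof.
  intros Ha Hd. pose proof (sqrt_pos a). pose proof (sqrt_pos d).
  enough (sqrt (a + d) <= sqrt a + sqrt d) by lra.
  apply Rsqr_incr_0_var; [|lra]. rewrite Rsqr_sqrt by lra. unfold Rsqr.
  pose proof (sqrt_sqrt a Ha). pose proof (sqrt_sqrt d Hd). nra.
Qed.

Lemma pos_between (a b u : R) : 0 < a -> 0 < b -> Rmin a b <= u -> 0 < u.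
Proof. intros Ha Hb Hu. pose proof (Rmin_pos a b Ha Hb). lra. Qed.

Section Potential.
Variable f : C -> C.
Hypothesis Hf : forall z, 0 < Re z -> holo_at f z.

Lemma goursat_unordered (a b c d : R) : 0 < a -> 0 < b ->
  (hintegral f c a b + Ci * vintegral f b c d)%C = (Ci * vintegral f a c d + hintegral f d a b)%C.
Proof.
  intros Ha Hb.
  assert (G : forall a b c d, 0 < a -> 0 < b -> a <= b -> c <= d ->
    (hintegral f c a b + Ci * vintegral f b c d)%C = (Ci * vintegral f a c d + hintegral f d a b)%C).
  { clear a b c d Ha Hb. intros a b c d Ha Hb Hab Hcd.
    assert (E : bdry f a b c d = 0).
    { apply goursat; auto. intros x y Hx _. apply Hf. simpl; lra. }
    unfold bdry in E.
    replace (hintegral f c a b + Ci * vintegral f b c d)%C with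
      ((hintegral f c a b + Ci * vintegral f b c d - hintegral f d a b - Ci * vintegral f a c d)
       + (Ci * vintegral f a c d + hintegral f d a b))%C by ring. rewrite E. ring. }
  assert (G2 : forall a b, 0 < a -> 0 < b -> a <= b ->
    (hintegral f c a b + Ci * vintegral f b c d)%C = (Ci * vintegral f a c d + hintegral f d a b)%C).
  { clear a b Ha Hb. intros a b Ha Hb Hab.
    destruct (Rle_lt_dec c d) as [L|L]; [now apply G|].
    specialize (G a b d c Ha Hb Hab ltac:(lra)).
    rewrite (vintegral_swap f b d c), (vintegral_swap f a d c).
    2,3: intros v _; apply Hf; simpl; lra.
    replace (hintegral f c a b + Ci * - vintegral f b d c)%C with
      ((Ci * vintegral f a d c + hintegral f c a b) - Ci * vintegral f a d c - Ci * vintegral f b d c)%C by ring.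
    rewrite <- G. ring. }
  destruct (Rle_lt_dec a b) as [L|L]; [now apply G2|].
  specialize (G2 b a Hb Ha ltac:(lra)).
  rewrite (hintegral_swap f c b a), (hintegral_swap f d b a).
  2,3: intros v Hv; apply Hf; simpl; apply (pos_between b a v); lra.
  replace (- hintegral f c b a + Ci * vintegral f b c d)%C with
    (Ci * vintegral f b c d - (hintegral f c b a + Ci * vintegral f a c d) + Ci * vintegral f a c d)%C by ring.
  rewrite G2. ring.
Qed.

Lemma potential_diff (z w : C) : 0 < Re z -> 0 < Re w ->
  (potential f w - potential f z)%C =
  (hintegral f (Im z) (Re z) (Re w) + Ci * vintegral f (Re w) (Im z) (Im w))%C.
Proof.
  intros Hz Hw. unfold potential.
  rewrite (hintegral_Chasles f 0 1 (Re z) (Re w)).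
  2,3: intros u Hu; apply Hf; simpl; eapply pos_between; [| |apply Hu]; lra.
  rewrite (vintegral_Chasles f (Re w) 0 (Im z) (Im w)).
  2,3: intros u Hu; apply Hf; simpl; lra.
  pose proof (goursat_unordered (Re z) (Re w) 0 (Im z) Hz Hw) as G.
  replace (hintegral f (Im z) (Re z) (Re w)) with
    (hintegral f 0 (Re z) (Re w) + Ci * vintegral f (Re w) 0 (Im z) - Ci * vintegral f (Re z) 0 (Im z))%C
    by (rewrite G; ring). ring.
Qed.

Lemma potential_first_order (z w : C) (l h : R) : 0 < Re z -> Re z <= Re w ->
  0 <= l -> Cmod (w - z) <= h ->
  (forall v, Re z <= Re v -> Cmod (f v - f z) <= l * Cmod (v - z)) ->
  Cmod (potential f w - potential f z - f z * (w - z)) <= 3 * l * (h * h).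
Proof.
  intros Hz Hzw Hl Hh Hlip. rewrite potential_diff by lra.
  set (c := f z).
  assert (X1 : @ex_RInt C_R_NormedModule (fun u => f (u, Im z)) (Re z) (Re w)).
  { apply ex_hintegral. intros u Hu. simpl_minmax. apply Hf. simpl; lra. }
  assert (X2 : @ex_RInt C_R_NormedModule (fun v => f (Re w, v)) (Im z) (Im w)).
  { apply ex_vintegral. intros u Hu. apply Hf. simpl; lra. }
  pose proof (re_le_Cmod (w - z)) as Dx. pose proof (im_le_Cmod (w - z)) as Dy.
  rewrite Re_minus in Dx. rewrite Im_minus in Dy.
  assert (E : (hintegral f (Im z) (Re z) (Re w) + Ci * vintegral f (Re w) (Im z) (Im w) - c * (w - z))%C =
    (@RInt CV (fun u => (f (u, Im z) - c)%C) (Re z) (Re w)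
     + Ci * @RInt CV (fun v => (f (Re w, v) - c)%C) (Im z) (Im w))%C).
  { rewrite !RInt_minus_const by auto. fold (hintegral f (Im z) (Re z) (Re w)).
    fold (vintegral f (Re w) (Im z) (Im w)).
    assert (W : (w - z)%C = (RtoC (Re w - Re z) + Ci * RtoC (Im w - Im z))%C).
    { destruct z, w. unfold RtoC, Ci, Cplus, Cmult, Cminus, Copp, Re, Im; simpl.
      unfold Cplus; simpl. f_equal; ring. }
    rewrite W. ring. }
  rewrite E. eapply Rle_trans; [apply Cmod_triangle|]. rewrite Cmod_mult, Cmod_Ci, Rmult_1_l.
  assert (H0 : 0 <= h) by (pose proof (Cmod_ge_0 (w - z)); lra).
  assert (B1 : Cmod (@RInt CV (fun u => (f (u, Im z) - c)%C) (Re z) (Re w))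
     <= Rabs (Re w - Re z) * (l * h)).
  { apply Cmod_RInt_le_abs; [now apply ex_RInt_minus_const|].
    intros u Hu. simpl_minmax. eapply Rle_trans; [apply Hlip; simpl; lra|].
    apply Rmult_le_compat_l; auto.
    pose proof (Cmod_horizontal_step (Re z) u (Im z)) as Eu.
    replace ((Re z, Im z) : C) with z in Eu by (destruct z; reflexivity).
    rewrite Eu, Rabs_pos_eq by lra. rewrite Rabs_pos_eq in Dx; lra. }
  assert (B2 : Cmod (@RInt CV (fun v => (f (Re w, v) - c)%C) (Im z) (Im w))
     <= Rabs (Im w - Im z) * (l * (2 * h))).
  { apply Cmod_RInt_le_abs; [now apply ex_RInt_minus_const|].
    intros v Hv. eapply Rle_trans; [apply Hlip; simpl; lra|].
    apply Rmult_le_compat_l; auto.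
    eapply Rle_trans; [apply Cmod_le_re_im|]. rewrite Re_minus, Im_minus. simpl.
    assert (Rabs (v - Im z) <= Rabs (Im w - Im z)).
    { destruct (Rle_lt_dec (Im z) (Im w)) as [L|L].
      - simpl_minmax. rewrite !Rabs_pos_eq; lra.
      - rewrite Rmin_right, Rmax_left in Hv by lra. rewrite !Rabs_left1; lra. }
    lra. }
  assert (Rabs (Re w - Re z) * (l * h) <= h * (l * h)).
  { apply Rmult_le_compat_r; [|lra]. now apply Rmult_le_pos. }
  assert (Rabs (Im w - Im z) * (l * (2 * h)) <= h * (l * (2 * h))).
  { apply Rmult_le_compat_r; [|lra]. apply Rmult_le_pos; lra. }
  lra.
Qed.

Variable B : R.
Hypothesis HB : 0 <= B.
Hypothesis Hbound : forall z, 0 < Re z -> Cmod (f z) <= B * (1 + / sqrt (Re z)).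

Lemma hintegral_inv_sqrt_bound (y a b : R) : 0 < a <= b ->
  Cmod (hintegral f y a b) <= B * ((b - a) + 2 * sqrt (b - a)).
Proof.
  intros Hab.
  apply Rle_trans with (B * (b + 2 * sqrt b) - B * (a + 2 * sqrt a)).
  - apply (Cmod_RInt_le (fun u => f (u, y)) (fun u => B * (1 + / sqrt u)) a b); [lra| | |].
    + apply ex_hintegral. intros u Hu. simpl_minmax. apply Hf. simpl; lra.
    + apply (is_RInt_derive (V := R_CompleteNormedModule) (fun u => B * (u + 2 * sqrt u))
        (fun u => B * (1 + / sqrt u))).
      * intros u Hu. simpl_minmax. auto_derive; [lra|].
        field. apply Rgt_not_eq, sqrt_lt_R0. lra.
      * intros u Hu. simpl_minmax. apply (ex_derive_continuous (fun u => B * (1 + / sqrt u))).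
        auto_derive. assert (0 < sqrt u) by (apply sqrt_lt_R0; lra).
        repeat split; lra.
    + intros u Hu. apply Hbound. simpl; lra.
  - pose proof (sqrt_sub_le a (b - a) ltac:(lra) ltac:(lra)) as Q.
    replace (a + (b - a)) with b in Q by ring.
    replace (B * (b + 2 * sqrt b) - B * (a + 2 * sqrt a))
      with (B * ((b - a) + 2 * (sqrt b - sqrt a))) by ring.
    apply Rmult_le_compat_l; lra.
Qed.

(** Integrate along the path that leaves the imaginary axis by the distance [D], moves
    vertically, and comes back: on the horizontal pieces [1 / sqrt x] is integrable, and on the
    vertical piece it is at most [1 / sqrt D]. *)
Lemma potential_path_bound (z w : C) : 0 < Re z -> Re z <= Re w ->
  let D := Cmod (w - z) in
  Cmod (potential f w - potential f z) <= B * (3 * D + 5 * sqrt D).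
Proof.
  intros Hz Hzw D.
  destruct (Rle_lt_or_eq_dec 0 D (Cmod_ge_0 _)) as [HD|HD].
  2:{ assert (E : (w - z)%C = 0) by (apply Cmod_eq_0; auto).
      replace w with (z + (w - z))%C by ring. rewrite E.
      replace (z + 0)%C with z by ring.
      replace (potential f z - potential f z)%C with (RtoC 0) by ring.
      rewrite Cmod_0, <- HD, sqrt_0. lra. }
  pose proof (re_le_Cmod (w - z)) as Dx. pose proof (im_le_Cmod (w - z)) as Dy.
  fold D in Dx, Dy. rewrite Re_minus in Dx. rewrite Im_minus in Dy. rewrite Rabs_pos_eq in Dx by lra.
  set (X := Re z + D).
  set (p := (X, Im z) : C). set (q := (X, Im w) : C).
  assert (S0 : 0 < sqrt D) by (apply sqrt_lt_R0; auto).
  assert (Z0 : forall g x y, vintegral g x y y = 0).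
  { intros g x y. apply (RInt_point (V := CV)). }
  assert (H0 : forall g y x, hintegral g y x x = 0).
  { intros g x y. apply (RInt_point (V := CV)). }
  assert (B1 : Cmod (potential f p - potential f z) <= B * (D + 2 * sqrt D)).
  { rewrite potential_diff by (simpl; unfold X; lra). simpl. rewrite Z0.
    replace (hintegral f (Im z) (Re z) X + Ci * 0)%C with (hintegral f (Im z) (Re z) X) by ring.
    eapply Rle_trans; [apply hintegral_inv_sqrt_bound; unfold X; lra|].
    unfold X. replace (Re z + D - Re z) with D by ring. lra. }
  assert (B3 : Cmod (potential f q - potential f w) <= B * (D + 2 * sqrt D)).
  { rewrite potential_diff by (simpl; unfold X; lra). simpl. rewrite Z0.
    replace (hintegral f (Im w) (Re w) X + Ci * 0)%C with (hintegral f (Im w) (Re w) X) by ring.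
    eapply Rle_trans; [apply hintegral_inv_sqrt_bound; unfold X; lra|].
    assert (sqrt (X - Re w) <= sqrt D) by (apply sqrt_le_1_alt; unfold X; lra).
    apply Rmult_le_compat_l; auto. unfold X in *. lra. }
  assert (B2 : Cmod (potential f q - potential f p) <= B * (D + sqrt D)).
  { rewrite potential_diff by (simpl; unfold X; lra). simpl. rewrite H0.
    replace (0 + Ci * vintegral f X (Im z) (Im w))%C with (Ci * vintegral f X (Im z) (Im w))%C by ring.
    rewrite Cmod_mult, Cmod_Ci, Rmult_1_l.
    apply Rle_trans with (Rabs (Im w - Im z) * (B * (1 + / sqrt D))).
    - apply Cmod_RInt_le_abs.
      + apply ex_vintegral. intros v _. apply Hf. simpl. unfold X; lra.
      + intros v _. eapply Rle_trans; [apply Hbound; simpl; unfold X; lra|].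
        apply Rmult_le_compat_l; auto. apply Rplus_le_compat_l. simpl.
        apply Rinv_le_contravar; auto. apply sqrt_le_1_alt. unfold X; lra.
    - apply Rle_trans with (D * (B * (1 + / sqrt D))).
      + apply Rmult_le_compat_r; auto. apply Rmult_le_pos; auto.
        assert (0 < / sqrt D) by (now apply Rinv_0_lt_compat). lra.
      + right. replace D with (sqrt D * sqrt D) at 1 3 by (apply sqrt_sqrt; lra). field. lra. }
  replace (potential f w - potential f z)%C with
    ((potential f p - potential f z) + (potential f q - potential f p)
     - (potential f q - potential f w))%C by ring.
  eapply Rle_trans; [apply Cmod_minus_le|].
  pose proof (Cmod_triangle (potential f p - potential f z) (potential f q - potential f p)). lra.
Qed.
End Potential.

(** * Displacement along trajectories *)

(** If [v = w * w] has [Re v >= 0] and [Re w >= 0], then [Re w ^ 3] is comparable to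
    [|v|^(3/2)]. So [- Re (v * w)] controls [|v|^(3/2)] up to a term in [Re v], which along a
    trajectory is the horizontal speed. *)
Lemma sqrt_cube_identity (w : C) :
  2 * Re w ^ 3 = - Re (w * w * w)%C + 3 * Re w * Re (w * w)%C.
Proof. destruct w as [p q]. unfold Cmult, Re; simpl. ring. Qed.

Lemma Cmod_sqr_le (w : C) : 0 <= Re (w * w)%C -> Cmod (w * w) <= 2 * Re w ^ 2.
Proof.
  intros H. rewrite Cmod_mult. replace (Cmod w * Cmod w) with (Cmod w ^ 2) by ring.
  rewrite Cmod2_alt. destruct w as [p q]. unfold Cmult, Re, Im in *; simpl in *. nra.
Qed.

(** Young's inequality, by comparing [p] with [1 / lam]. *)
Lemma square_le_cube (p lam : R) : 0 < lam -> 0 <= p -> p ^ 2 <= lam * p ^ 3 + / lam ^ 2.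
Proof.
  intros Hl Hp.
  assert (Hi : 0 < / lam ^ 2) by (apply Rinv_0_lt_compat, pow_lt; auto).
  destruct (Rle_lt_dec 1 (lam * p)) as [L|L].
  - assert (p ^ 2 * 1 <= p ^ 2 * (lam * p)) by (apply Rmult_le_compat_l; nra).
    replace (lam * p ^ 3) with (p ^ 2 * (lam * p)) by ring. lra.
  - assert (0 <= lam * p ^ 3) by (apply Rmult_le_pos; [lra|now apply pow_le]).
    enough (p ^ 2 <= / lam ^ 2) by lra.
    apply Rmult_le_reg_r with (lam ^ 2); [apply pow_lt; auto|].
    rewrite Rinv_l by (apply pow_nonzero; lra).
    replace (p ^ 2 * lam ^ 2) with ((lam * p) * (lam * p)) by ring.
    assert (0 <= lam * p) by nra. nra.
Qed.

(** A left Riemann sum of [1 / sqrt x] is comparable to its integral [2 sqrt x]. *)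
Lemma inv_sqrt_step (x x' : R) : 0 < x -> x <= x' <= 4 * x ->
  (x' - x) * / sqrt x <= 3 * (sqrt x' - sqrt x).
Proof.
  intros Hx Hx'.
  assert (Hs : 0 < sqrt x) by (apply sqrt_lt_R0; auto).
  assert (Hs1 : sqrt x <= sqrt x') by (apply sqrt_le_1_alt; lra).
  assert (Hs2 : sqrt x' <= 2 * sqrt x).
  { replace 2 with (sqrt (2 * 2)) by (apply sqrt_square; lra).
    rewrite <- sqrt_mult by lra. apply sqrt_le_1_alt. lra. }
  pose proof (sqrt_sqrt x ltac:(lra)). pose proof (sqrt_sqrt x' ltac:(lra)).
  apply Rmult_le_reg_r with (sqrt x); auto. rewrite Rmult_assoc, Rinv_l by lra.
  nra.
Qed.

(** A trajectory [z] of [N] steps of time [1 / N] with velocity field [psi]. The root [G] of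
    [psi] (shifted by [eta] to have a root everywhere) satisfies
    [Cmod (G w) <= B * (1 + 1 / sqrt (Re w))]. The sum of [G (z k) * (z (S k) - z k)] is a
    Riemann sum of the path-independent integral of [G dw], which is small; it is also the mean
    of [psi^(3/2)] along the trajectory, which controls the mean of [|psi|], hence the
    displacement. The auxiliary parameter [lam] stands for the use of Hoelder's inequality. *)
Section Trajectory.
Variables (psi : C -> C) (A lam : R) (z : nat -> C) (N : nat).
Hypothesis HA : 0 < A.
Hypothesis Hlam : 0 < lam.
Hypothesis HN : (0 < N)%nat.
Hypothesis Hpsi : forall w, 0 < Re w -> holo_at psi w.
Hypothesis Hre : forall w, 0 < Re w -> 0 <= Re (psi w).
Hypothesis Hbd : forall w, 0 < Re w -> Cmod (psi w) <= A + 4 * A / Re w.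
Hypothesis Hz0 : 0 < Re (z O).
Hypothesis Hstep : forall k, (k < N)%nat -> (z (S k) - z k)%C = (RtoC (/ INR N) * psi (z k))%C.

Let x0 := Re (z O).
Let M := A + 8 * A / x0.
Let eta := A / INR N.
Let Bg := sqrt (M + A).
Let ell := 4 * Bg / x0.
Let G w := Csqrt (psi w + RtoC eta).
Let B := 2 * sqrt A.

Hypothesis HNM : M / INR N <= 3 * x0.

Let HNr : 1 <= INR N.
Proof. apply (le_INR 1). lia. Qed.

Let Heta : 0 < eta.
Proof. apply Rdiv_lt_0_compat; lra. Qed.

Let Heta_le : eta <= A.
Proof.
  unfold eta. apply Rmult_le_reg_r with (INR N); [lra|].
  unfold Rdiv. rewrite Rmult_assoc, Rinv_l by lra. nra.
Qed.

Let Hx0 : 0 < x0.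
Proof. exact Hz0. Qed.

Let HM : 0 < M.
Proof. unfold M. assert (0 < 8 * A / x0) by (apply Rdiv_lt_0_compat; lra). lra. Qed.

Let Re_shift_pos (w : C) : 0 < Re w -> 0 < Re (psi w + RtoC eta)%C.
Proof. intros Hw. rewrite Re_plus, Re_RtoC. specialize (Hre w Hw). lra. Qed.

Let G_sqr (w : C) : 0 < Re w -> (G w * G w)%C = (psi w + RtoC eta)%C.
Proof. intros Hw. now apply Csqrt_sqr, Re_shift_pos. Qed.

Let G_pos (w : C) : 0 < Re w -> 0 < Re (G w).
Proof. intros Hw. now apply Re_Csqrt_pos, Re_shift_pos. Qed.

Let G_holo (w : C) : 0 < Re w -> holo_at G w.
Proof.
  intros Hw. apply (holo_comp Csqrt (fun w => psi w + RtoC eta)%C).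
  - now apply Cderiv_Csqrt, Re_shift_pos.
  - apply holo_plus; [auto|apply holo_const].
Qed.

Let G_sq_le (w : C) : 0 < Re w -> Cmod (G w) * Cmod (G w) <= 2 * A + 4 * A / Re w.
Proof.
  intros Hw. rewrite <- Cmod_mult, G_sqr by auto.
  eapply Rle_trans; [apply Cmod_triangle|]. rewrite Cmod_R, Rabs_pos_eq by lra.
  specialize (Hbd w Hw). lra.
Qed.

Let G_bound (w : C) : 0 < Re w -> Cmod (G w) <= B * (1 + / sqrt (Re w)).
Proof.
  intros Hw. pose proof (G_sq_le w Hw) as Q.
  assert (Hs : 0 < / sqrt (Re w)) by (apply Rinv_0_lt_compat, sqrt_lt_R0; auto).
  assert (HsA : 0 < sqrt A) by (apply sqrt_lt_R0; auto).
  apply Rsqr_incr_0_var.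
  2:{ unfold B. apply Rmult_le_pos; lra. }
  unfold Rsqr. eapply Rle_trans; [exact Q|].
  assert (E : / sqrt (Re w) * / sqrt (Re w) = / Re w).
  { rewrite <- Rinv_mult, sqrt_sqrt; lra. }
  unfold B. replace (2 * sqrt A * (1 + / sqrt (Re w)) * (2 * sqrt A * (1 + / sqrt (Re w))))
    with (4 * (sqrt A * sqrt A) * (1 + 2 * / sqrt (Re w) + / sqrt (Re w) * / sqrt (Re w))) by ring.
  rewrite E, sqrt_sqrt by lra. unfold Rdiv.
  assert (0 < A * / sqrt (Re w)) by (apply Rmult_lt_0_compat; auto). nra.
Qed.

Let G_bounded (w : C) : x0 / 2 <= Re w -> Cmod (G w) <= Bg.
Proof.
  intros Hw. pose proof (G_sq_le w ltac:(lra)) as Q.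
  apply Rsqr_incr_0_var; [|apply sqrt_pos]. unfold Rsqr, Bg. rewrite sqrt_sqrt by lra.
  eapply Rle_trans; [exact Q|]. unfold M.
  assert (4 * A / Re w <= 8 * A / x0); [|lra].
  replace (8 * A / x0) with (4 * A * / (x0 / 2)) by (field; lra).
  apply Rmult_le_compat_l; [lra|]. apply Rinv_le_contravar; lra.
Qed.

Let psi_bounded (w : C) : x0 <= Re w -> Cmod (psi w) <= M.
Proof.
  intros Hw. eapply Rle_trans; [apply Hbd; lra|]. unfold M.
  assert (4 * A / Re w <= 8 * A / x0); [|lra].
  replace (8 * A / x0) with (8 * A * / x0) by reflexivity.
  apply Rmult_le_compat; try lra.
  - left; apply Rinv_0_lt_compat; lra.
  - apply Rinv_le_contravar; lra.
Qed.

Let x_mono (k : nat) : (k <= N)%nat -> x0 <= Re (z k).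
Proof.
  induction k as [|k IH]; intros Hk; [unfold x0; lra|].
  specialize (IH ltac:(lia)). pose proof (f_equal Re (Hstep k ltac:(lia))) as E.
  rewrite Re_minus, Re_mult_R in E. specialize (Hre (z k) ltac:(lra)).
  assert (0 < / INR N) by (apply Rinv_0_lt_compat; lra). nra.
Qed.

Let E1 := 3 * ell * (M * M) + 2 * A * Bg.

(** The differences telescope over [k]; over [N] steps the other terms add up to
    [2 / lam ^ 2] and a quantity of order [1 / N]. *)
Lemma step_bound (k : nat) : (k < N)%nat ->
  let P := potential G in
  Cmod (z (S k) - z k) <=
    lam * (- Re (P (z (S k)) - P (z k))%C
      + 3 * B * ((Re (z (S k)) - Re (z k)) + 3 * (sqrt (Re (z (S k))) - sqrt (Re (z k))))
      + E1 / INR N ^ 2)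
    + 2 / lam ^ 2 / INR N + A / INR N ^ 2.
Proof.
  intros Hk P. set (n := INR N) in *.
  assert (Hn : 0 < / n) by (apply Rinv_0_lt_compat; lra).
  pose proof (Hstep k Hk) as Es. set (w := z k) in *. set (w' := z (S k)) in *.
  assert (Hw : x0 <= Re w) by (apply x_mono; lia).
  assert (Hw0 : 0 < Re w) by lra.
  specialize (Hre w Hw0). pose proof (psi_bounded w Hw) as Hpb.
  assert (ERe : Re w' - Re w = / n * Re (psi w)).
  { rewrite <- Re_minus, Es, Re_mult_R. reflexivity. }
  assert (Em : Cmod (w' - w) = / n * Cmod (psi w)).
  { rewrite Es, Cmod_mult, Cmod_R, Rabs_pos_eq; lra. }
  assert (Hww' : Re w <= Re w') by nra.
  assert (Hstep_le : Cmod (w' - w) <= M / n).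
  { rewrite Em. unfold Rdiv. rewrite Rmult_comm. apply Rmult_le_compat_r; lra. }
  pose proof (G_pos w Hw0) as Hp. pose proof (G_sqr w Hw0) as Hsq.
  set (p := Re (G w)) in *.
  assert (HpB : p <= Bg).
  { eapply Rle_trans; [apply Rle_abs|]. eapply Rle_trans; [apply re_le_Cmod|].
    apply G_bounded; lra. }
  assert (Hpb2 : p <= B * (1 + / sqrt (Re w))).
  { eapply Rle_trans; [apply Rle_abs|]. eapply Rle_trans; [apply re_le_Cmod|]. now apply G_bound. }
  assert (Hlin : Cmod (P w' - P w - G w * (w' - w)) <= 3 * ell * (M / n * (M / n))).
  { apply potential_first_order; auto.
    - unfold ell. apply Rmult_le_pos; [|left; now apply Rinv_0_lt_compat].
      pose proof (sqrt_pos (M + A)). unfold Bg. lra.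
    - intros v Hv. apply (lipschitz_of_bounded G x0 Bg); auto; lra. }
  assert (Hre1 : - Re (G w * (w' - w))%C <= - Re (P w' - P w)%C + 3 * ell * (M / n * (M / n))).
  { pose proof (re_le_Cmod (P w' - P w - G w * (w' - w))) as Q. rewrite Re_minus in Q.
    pose proof (proj1 (Rabs_le_between _ _) (Rle_trans _ _ _ Q Hlin)). lra. }
  assert (Hcube : 2 * p ^ 3 / n = - Re (G w * (w' - w))%C - eta / n * p
     + 3 * p * (Re w' - Re w) + 3 * p * (eta / n)).
  { unfold Rdiv at 1. unfold p at 1. rewrite sqrt_cube_identity, Hsq. fold p.
    rewrite Re_plus, Re_RtoC, ERe.
    replace (Re ((psi w + RtoC eta) * G w)%C) with (Re (G w * psi w)%C + eta * p).
    2:{ replace ((psi w + RtoC eta) * G w)%C with (G w * psi w + RtoC eta * G w)%C by ring.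
        rewrite Re_plus, Re_mult_R. reflexivity. }
    rewrite Es. replace (G w * (RtoC (/ n) * psi w))%C
      with (RtoC (/ n) * (G w * psi w))%C by ring.
    rewrite Re_mult_R. field. lra. }
  assert (Hx : p * (Re w' - Re w) <= B * ((Re w' - Re w) + 3 * (sqrt (Re w') - sqrt (Re w)))).
  { assert (HB : 0 <= B) by (unfold B; pose proof (sqrt_pos A); lra).
    apply Rle_trans with (B * (1 + / sqrt (Re w)) * (Re w' - Re w)).
    - apply Rmult_le_compat_r; lra.
    - rewrite Rmult_assoc. apply Rmult_le_compat_l; auto.
      pose proof (inv_sqrt_step (Re w) (Re w') Hw0) as Q.
      assert (Re w' <= 4 * Re w).
      { pose proof (re_le_Cmod (w' - w)) as Q'. rewrite Re_minus in Q'.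
        pose proof (proj1 (Rabs_le_between _ _) (Rle_trans _ _ _ Q' Hstep_le)). lra. }
      specialize (Q ltac:(lra)). lra. }
  assert (Hep : 2 * p * (eta / n) <= 2 * A * Bg / n ^ 2).
  { unfold eta. fold n. replace (2 * p * (A / n / n)) with (2 * A * p / n ^ 2) by (field; lra).
    apply Rmult_le_compat_r; [left; apply Rinv_0_lt_compat, pow_lt; lra|]. nra. }
  assert (Hcube2 : 2 * p ^ 3 / n <= - Re (P w' - P w)%C
     + 3 * B * ((Re w' - Re w) + 3 * (sqrt (Re w') - sqrt (Re w))) + E1 / n ^ 2).
  { unfold E1. replace ((3 * ell * (M * M) + 2 * A * Bg) / n ^ 2)
      with (3 * ell * (M / n * (M / n)) + 2 * A * Bg / n ^ 2) by (field; lra). lra. }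
  assert (Hlen : Cmod (psi w) <= 2 * p ^ 2 + eta).
  { pose proof (Cmod_sqr_le (G w)) as Q. rewrite Hsq in Q.
    specialize (Q ltac:(rewrite Re_plus, Re_RtoC; lra)). fold p in Q.
    replace (psi w) with ((psi w + RtoC eta) - RtoC eta)%C by ring.
    eapply Rle_trans; [apply Cmod_minus_le|]. rewrite Cmod_R, Rabs_pos_eq by lra. lra. }
  pose proof (square_le_cube p lam Hlam ltac:(lra)) as Hsc.
  rewrite Em.
  apply Rle_trans with (/ n * (2 * (lam * p ^ 3 + / lam ^ 2) + eta)).
  { apply Rmult_le_compat_l; lra. }
  replace (/ n * (2 * (lam * p ^ 3 + / lam ^ 2) + eta))
    with (lam * (2 * p ^ 3 / n) + 2 / lam ^ 2 / n + A / n ^ 2).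
  2:{ unfold eta. fold n. field. lra. }
  apply Rplus_le_compat_r, Rplus_le_compat_r. apply Rmult_le_compat_l; lra.
Qed.

Lemma trajectory_bound : let D := Cmod (z N - z O) in
  D <= 28 * lam * sqrt A * (D + sqrt D) + 2 / lam ^ 2 + (lam * E1 + A) / INR N.
Proof.
  intros D. set (P := potential G). set (n := INR N) in *.
  assert (Hsum : forall k, (k <= N)%nat -> Cmod (z k - z O) <=
    lam * (- Re (P (z k) - P (z O))%C
      + 3 * B * ((Re (z k) - Re (z O)) + 3 * (sqrt (Re (z k)) - sqrt (Re (z O))))
      + INR k * (E1 / n ^ 2))
    + INR k * (2 / lam ^ 2 / n + A / n ^ 2)).
  { induction k as [|k IH]; intros Hk.
    - replace (z O - z O)%C with (RtoC 0) by ring.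
      replace (P (z O) - P (z O))%C with (RtoC 0) by ring.
      rewrite Cmod_0, Re_RtoC. simpl INR. right. ring.
    - specialize (IH ltac:(lia)). pose proof (step_bound k ltac:(lia)) as S1.
      cbv zeta in S1. fold P in S1. fold n in S1.
      replace (z (S k) - z O)%C with ((z k - z O) + (z (S k) - z k))%C by ring.
      eapply Rle_trans; [apply Cmod_triangle|]. rewrite S_INR.
      rewrite !Re_minus in *. lra. }
  specialize (Hsum N (le_n N)). fold n in Hsum. fold D in Hsum.
  assert (HB : 0 <= B) by (unfold B; pose proof (sqrt_pos A); lra).
  pose proof (x_mono N (le_n N)) as HxN.
  pose proof (potential_path_bound G (fun w Hw => G_holo w Hw) B HB (fun w Hw => G_bound w Hw)
    (z O) (z N) Hz0 HxN) as Hpath. cbv zeta in Hpath. fold D in Hpath. fold P in Hpath.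
  pose proof (re_le_Cmod (P (z N) - P (z O))) as Q.
  pose proof (proj1 (Rabs_le_between _ _) (Rle_trans _ _ _ Q Hpath)) as Q'.
  pose proof (re_le_Cmod (z N - z O)) as Dx. rewrite Re_minus in Dx. fold D in Dx.
  fold x0 in Dx, Hsum. rewrite Rabs_pos_eq in Dx by lra.
  assert (Hsq : sqrt (Re (z N)) - sqrt x0 <= sqrt D).
  { eapply Rle_trans; [|apply sqrt_le_1_alt; exact Dx].
    pose proof (sqrt_sub_le x0 (Re (z N) - x0) ltac:(lra) ltac:(lra)) as T.
    now replace (x0 + (Re (z N) - x0)) with (Re (z N)) in T by ring. }
  assert (T : - Re (P (z N) - P (z O))%C
      + 3 * B * ((Re (z N) - x0) + 3 * (sqrt (Re (z N)) - sqrt x0))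
      <= B * (14 * (D + sqrt D))).
  { assert (0 <= D) by apply Cmod_ge_0.
    assert (3 * B * ((Re (z N) - x0) + 3 * (sqrt (Re (z N)) - sqrt x0))
      <= 3 * B * (D + 3 * sqrt D)) by (apply Rmult_le_compat_l; lra).
    assert (0 <= B * D) by (apply Rmult_le_pos; lra). lra. }
  assert (T2 : lam * (- Re (P (z N) - P (z O))%C
      + 3 * B * ((Re (z N) - x0) + 3 * (sqrt (Re (z N)) - sqrt x0)) + n * (E1 / n ^ 2))
    <= lam * (B * (14 * (D + sqrt D)) + n * (E1 / n ^ 2))) by (apply Rmult_le_compat_l; lra).
  replace (28 * lam * sqrt A * (D + sqrt D) + 2 / lam ^ 2 + (lam * E1 + A) / n)
    with (lam * (B * (14 * (D + sqrt D)) + n * (E1 / n ^ 2)) + n * (2 / lam ^ 2 / n + A / n ^ 2)).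
  2:{ unfold B. field. split; lra. }
  lra.
Qed.
End Trajectory.

Lemma le_of_le_add_div (D Q E N0 : R) :
  (forall N : nat, N0 <= INR N -> (0 < N)%nat -> D <= Q + E / INR N) -> D <= Q.
Proof.
  intros H. apply Rle_plus_epsilon. intros e He.
  set (y := Rmax N0 (Rabs E / e)).
  destruct (INR_unbounded y) as [N HN].
  pose proof (Rmax_l N0 (Rabs E / e)). pose proof (Rmax_r N0 (Rabs E / e)). fold y in H0, H1.
  assert (0 <= Rabs E / e) by (apply Rdiv_le_0_compat; [apply Rabs_pos|lra]).
  assert (HNp : 0 < INR N) by lra.
  specialize (H N ltac:(lra) ltac:(apply INR_lt; simpl; lra)).
  assert (E / INR N <= e); [|lra].
  apply Rmult_le_reg_r with (INR N); auto. unfold Rdiv. rewrite Rmult_assoc, Rinv_l by lra.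
  pose proof (Rle_abs E).
  assert (Rabs E <= e * INR N).
  { replace (Rabs E) with (e * (Rabs E / e)) by (field; lra). apply Rmult_le_compat_l; lra. }
  lra.
Qed.

(** The trajectory of [z] under [Phi (t / N)] moves with the velocity field
    [N (Phi (t / N) w - w)], which satisfies the hypotheses above uniformly in [N] because drifts
    are additive in time; let [N] tend to infinity. *)
Lemma displacement_estimate (Phi : R -> C -> C) (t A lam : R) (a z : C) :
  continuous_semigroup Phi -> (forall s, 0 < s -> exists b, drift (Phi s) b) ->
  0 < t -> drift (Phi t) a -> 0 < A -> Cmod a <= A -> 0 < lam -> 0 < Re z ->
  let D := Cmod (Phi t z - z) in
  D <= 28 * lam * sqrt A * (D + sqrt D) + 2 / lam ^ 2.
Proof.
  intros HS Hdr Ht Hta HA HaA Hlam Hz D.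
  set (M := A + 8 * A / Re z).
  apply (le_of_le_add_div D _ (lam * (3 * (4 * sqrt (M + A) / Re z) * (M * M)
    + 2 * A * sqrt (M + A)) + A) (M / (3 * Re z))).
  intros N HN1 HN.
  assert (HNr : 0 < INR N) by now apply lt_0_INR.
  set (s := t / INR N).
  assert (Hs : 0 < s) by now apply Rdiv_lt_0_compat.
  destruct (Hdr s Hs) as [b Hb].
  assert (Eab : a = (RtoC (INR N) * b)%C).
  { destruct N as [|n]; [lia|]. apply (drift_multiple Phi HS Hdr s b n a Hs Hb).
    unfold s. now replace (INR (S n) * (t / INR (S n))) with t by (field; lra). }
  set (psi := fun w => (RtoC (INR N) * (Phi s w - w))%C).
  set (orbit := fun k : nat => Phi (INR k * s) z).
  assert (Z0 : orbit O = z).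
  { unfold orbit. simpl INR. rewrite Rmult_0_l. now apply (csg_id _ HS). }
  assert (ZN : orbit N = Phi t z).
  { unfold orbit, s. f_equal. field. lra. }
  assert (Zpos : forall k, 0 < Re (orbit k)).
  { intros k. apply (csg_self_map _ HS); auto. apply Rmult_le_pos; [apply pos_INR|lra]. }
  destruct Hb as [Hb0 [Hbpos Hbd]].
  assert (Hpre : forall w, 0 < Re w -> 0 <= Re (psi w)).
  { intros w Hw. unfold psi. rewrite Re_mult_R. apply Rmult_le_pos; [lra|now apply Hbpos]. }
  assert (Hpbd : forall w, 0 < Re w -> Cmod (psi w) <= A + 4 * A / Re w).
  { intros w Hw. specialize (Hbd w Hw).
    assert (Ea : INR N * Cmod b <= A).
    { rewrite Eab, Cmod_mult, Cmod_R, Rabs_pos_eq in HaA; lra. }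
    assert (Eb : Re b <= Cmod b) by (eapply Rle_trans; [apply Rle_abs|apply re_le_Cmod]).
    unfold psi. rewrite Cmod_mult, Cmod_R, Rabs_pos_eq by lra.
    pose proof (Cmod_le_add (Phi s w - w) b) as T.
    assert (Cmod (Phi s w - w - b) <= 4 * Cmod b / Re w).
    { apply Rmult_le_reg_r with (Re w); auto. unfold Rdiv. rewrite Rmult_assoc, Rinv_l; lra. }
    apply Rle_trans with (INR N * (Cmod b + 4 * Cmod b / Re w)).
    - apply Rmult_le_compat_l; lra.
    - replace (INR N * (Cmod b + 4 * Cmod b / Re w))
        with (INR N * Cmod b * (1 + 4 / Re w)) by (field; lra).
      replace (A + 4 * A / Re w) with (A * (1 + 4 / Re w)) by (field; lra).
      assert (0 < 4 / Re w) by (apply Rdiv_lt_0_compat; lra).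
      apply Rmult_le_compat_r; lra. }
  pose proof (trajectory_bound psi A lam orbit N HA Hlam HN) as T.
  rewrite Z0, ZN in T. fold D in T. apply T; auto.
  - intros w Hw. apply holo_mult; [apply holo_const|]. apply holo_minus; [|apply holo_id].
    destruct (csg_holomorphic _ HS s ltac:(lra) w Hw) as [l Hl].
    exists l. now apply Cderiv_of_is_derive.
  - intros k _. unfold psi. rewrite Cmult_assoc, <- RtoC_mult, Rinv_l by lra.
    rewrite Cmult_1_l. f_equal. unfold orbit.
    rewrite (csg_comp _ HS); auto; [|lra|apply Rmult_le_pos; [apply pos_INR|lra]].
    f_equal. rewrite S_INR. ring.
  - fold M. apply Rmult_le_reg_r with (INR N); auto.
    unfold Rdiv at 1. rewrite Rmult_assoc, Rinv_l by lra.
    replace (M * 1) with (3 * Re z * (M / (3 * Re z))) by (field; lra).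
    apply Rmult_le_compat_l; lra.
Qed.

(** If [D > e], then [D + sqrt D <= 2 D / sqrt e], and the first term is absorbed by taking
    [lam] proportional to [sqrt e / sqrt A]. *)
Lemma small_of_displacement_estimate (D A e : R) : 0 <= D -> 0 < e <= 1 -> 0 < A ->
  sqrt A = e / 224 ->
  (forall lam, 0 < lam -> D <= 28 * lam * sqrt A * (D + sqrt D) + 2 / lam ^ 2) -> D <= e.
Proof.
  intros HD He HA HsA H. destruct (Rle_lt_dec D e) as [|L]; auto. exfalso.
  set (r := sqrt e).
  assert (Hr : 0 < r) by (apply sqrt_lt_R0; lra).
  assert (Hrr : r * r = e) by (apply sqrt_sqrt; lra).
  assert (Hr1 : r <= 1) by nra.
  assert (Hs : sqrt D <= D / r).
  { assert (r <= sqrt D) by (apply sqrt_le_1_alt; lra).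
    pose proof (sqrt_sqrt D HD). apply Rmult_le_reg_r with r; auto.
    unfold Rdiv. rewrite Rmult_assoc, Rinv_l by lra. nra. }
  assert (Hs2 : D <= D / r).
  { apply Rmult_le_reg_r with r; auto. unfold Rdiv. rewrite Rmult_assoc, Rinv_l by lra. nra. }
  (* this makes the first term at most D / 2 *)
  set (lam := r / (112 * sqrt A)).
  assert (HsA0 : 0 < sqrt A) by lra.
  assert (Hl : 0 < lam) by (apply Rdiv_lt_0_compat; lra).
  specialize (H lam Hl).
  assert (T1 : 28 * lam * sqrt A * (D + sqrt D) <= D / 2).
  { apply Rle_trans with (28 * lam * sqrt A * (2 * (D / r))).
    - apply Rmult_le_compat_l; [apply Rmult_le_pos; lra|lra].
    - right. unfold lam. field. lra. }
  assert (T2 : 2 / lam ^ 2 = e / 2).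
  { unfold lam. rewrite HsA, <- Hrr. field. lra. }
  lra.
Qed.

Theorem corollary1p3 (Phi : R -> C -> C)
  (Phi_semigroup : continuous_semigroup Phi)
  (Phi_G : forall t : R, (0 < t)%R -> class_G (Phi t)) :
  cvg_unif_at_0 (half_plane 0) Phi (fun z : C => z).
Proof.
  intros eps.
  assert (Hdr : forall t, 0 < t -> exists a, drift (Phi t) a).
  { intros t Ht. apply expansion_drift.
    - apply (csg_holomorphic _ Phi_semigroup). lra.
    - apply (csg_self_map _ Phi_semigroup). lra.
    - now apply coefficient_one. }
  set (e := Rmin (eps / 2) 1).
  assert (He : 0 < e) by (apply Rmin_pos; [pose proof (cond_pos eps); lra|lra]).
  assert (He1 : e <= 1) by apply Rmin_r. assert (He2 : e <= eps / 2) by apply Rmin_l.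
  set (A := (e / 224) * (e / 224)).
  assert (HsA : sqrt A = e / 224) by (apply sqrt_square; lra).
  assert (HA : 0 < A) by (unfold A; nra).
  destruct (drift_small Phi Phi_semigroup A HA) as [d [Hd B]].
  exists (mkposreal d Hd). intros t Ht Ht0 z Hz.
  change (Rabs (t - 0) < d) in Ht. rewrite Rabs_pos_eq in Ht by lra.
  destruct (Hdr t Ht0) as [a Ha].
  apply Rle_lt_trans with e; [|pose proof (cond_pos eps); lra].
  apply (small_of_displacement_estimate _ A e); auto; [apply Cmod_ge_0|].
  intros lam Hlam. apply (displacement_estimate Phi t A lam a z); auto. apply (B t); auto. lra.
Qed.
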